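(* For $i=1,2,3$ let $G_i$ be an $r_i$-regular graph with $n_i\ge1$ vertices and $m_i$ edges, where $G_1$ is connected and $r_1\ge1$. Let $\theta_i$ ($1\le i\le n_1$), $\mu_j$ ($1\le j\le n_2$), $\eta_k$ ($1\le k\le n_3$) be the eigenvalues of $\mathcal L(G_1)$, $\mathcal L(G_2)$, $\mathcal L(G_3)$, respectively, each listed in non-increasing order with multiplicity (so $\theta_{n_1}=\mu_{n_2}=\eta_{n_3}=0$). Let $\mathcal G=G_1^S\bowtie(G_2^V\cup G_3^E)$ and $\mathfrak G=G_1^S\diamondsuit(G_2^V\cup G_3^E)$, and let $K(\cdot)$ denote Kemeny's constant. Then (1) $$K(\mathcal G)=\sum_{j=1}^{n_2-1}\tfrac{n_1(r_1+r_2)}{r_1+r_2\mu_j}+\sum_{i=1}^{n_1-1}\tfrac{(4r_1+r_2+r_1r_3)(2n_2+n_3+2)-n_3(2r_1+r_2)-(2-\theta_i)\left((1+n_2)(2r_1+r_1r_3)+r_2\right)}{r_1(1+n_2)\theta_i}$$ $$+\tfrac{(m_1-n_1)(r_3+2)(2n_2+n_3+2)}{2n_2+2}+\tfrac{(2n_2+n_3+2)(6r_1+3r_2+3r_1r_3+r_2r_3)-n_3(r_1+r_2)-2(r_3+1)(r_1+r_2+r_1n_2)}{(4r_1+r_2+r_1r_3)(2n_2+n_3+2)-(2r_1n_3+r_2n_3+2r_2)-(2+2n_2)(2r_1+r_1r_3)}+\sum_{k=1}^{n_3-1}\tfrac{m_1(r_3+1)}{1+r_3\eta_k};$$ (2)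 $$K(\mathfrak G)=\sum_{i=1}^{n_1-1}\tfrac{2(r_1n_2+r_1+n_3)(2r_3+r_2+8)-(2r_2n_3+8n_3)-r_1(2-\theta_i)\left((2+2n_2)(2+r_3)+r_2\right)}{r_1(2+2n_2)\theta_i}+\sum_{j=1}^{n_2-1}\tfrac{m_1(r_2+2)}{2+r_2\mu_j}$$ $$+\tfrac{(r_2+4)(m_1-n_1)}{2}+\tfrac{2(r_1n_2+r_1+n_3)(r_2r_3+6r_3+3r_2+12)-n_3(2r_2+4)-2r_1(r_3+1)(2n_2+r_2+2)}{2n_2r_1r_2+8n_2r_1+4n_3r_3+8n_3+8r_1}+\sum_{k=1}^{n_3-1}\tfrac{n_1(r_3+1)}{1+r_3\eta_k}.$$
   Context: All graphs are finite, simple and undirected. The normalized Laplacian matrix of $G$ is $\mathcal L(G)=I-D(G)^{-1/2}A(G)D(G)^{-1/2}$, where $A(G)$ is the adjacency matrix and $D(G)$ the diagonal degree matrix; rows and columns of $\mathcal L(G)$ indexed by isolated vertices are taken to be zero (e.g. $\mathcal L(K_1)=(0)$). Kemeny's constant $K(G)$ of a connected graph $G$ is the expected number of steps for the unbiased random walk on $G$ to go from a starting vertex to a destination vertex chosen at random according to the stationary distribution (zero steps if the destination equals the start). It is known that for a connected graph with $n$ vertices and normalized Laplacian eigenvalues $\lambda_1\ge\dots\ge\lambda_{n-1}>\lambda_n=0$, $K(G)=\sum_{i=1}^{n-1}\frac{1}{\lambda_i}$; this formula may be taken as the definition. The subdivision graph $S(G_1)$ is obtained by inserting a new vertex into every edge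 of $G_1$; its vertex set is $V(G_1)\cup I(G_1)$, where $I(G_1)$ is the set of inserted vertices, in bijection with the edges of $G_1$. The graph $G_1^S\bowtie(G_2^V\cup G_3^E)$ (subdivision vertex-edge neighbourhood vertex-corona) consists of $S(G_1)$, $|V(G_1)|$ copies of $G_2$ and $|I(G_1)|$ copies of $G_3$, all vertex-disjoint, where for each $i$ every neighbour in $S(G_1)$ of the $i$-th vertex of $V(G_1)$ is joined to every vertex of the $i$-th copy of $G_2$, and for each $i$ the $i$-th vertex of $I(G_1)$ is joined to every vertex of the $i$-th copy of $G_3$. The graph $G_1^S\diamondsuit(G_2^V\cup G_3^E)$ (subdivision vertex-edge neighbourhood edge-corona) consists of $S(G_1)$, $|I(G_1)|$ copies of $G_2$ and $|V(G_1)|$ copies of $G_3$, all vertex-disjoint, where for each $i$ every neighbour in $S(G_1)$ of the $i$-th vertex of $I(G_1)$ is joined to every vertex of the $i$-th copy of $G_2$, and for each $i$ the $i$-th vertex of $V(G_1)$ is joined to every vertex of the $i$-th copy of $G_3$. *)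

(* Defs.v *)
From HB Require Import structures.
From mathcomp Require Import all_boot all_order all_algebra.
From mathcomp Require Import polyrcf.
Set Implicit Arguments.
Unset Strict Implicit.
Unset Printing Implicit Defensive.
Import Order.TTheory GRing.Theory Num.Theory.
Local Open Scope ring_scope.

Record sgraph := SGraph {
  vertex :> finType;
  adj : rel vertex;
  adj_sym : symmetric adj;
  adj_irr : irreflexive adj }.

Definition edges (G : sgraph) : {set {set G}} :=
  [set [set p.1; p.2] | p : G * G & adj p.1 p.2].

Definition edge (G : sgraph) : finType := {e : {set G} | e \in edges G}.

Definition degree (G : sgraph) (x : G) : nat := #|[set y | adj x y]|.

Definition regular (G : sgraph) (r : nat) : Prop :=
  forall x : G, degree x = r.

Definition connected (G : sgraph) : Prop :=
  (0 < #|G|)%N /\ forall x y : G, connect (@adj G) x y.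

(* V(S(G)) = V(G) + I(G), the inserted vertices being the edges of G. *)
Definition subdiv_adj (G : sgraph) : rel (G + edge G) := fun a b =>
  match a, b with
  | inl v, inr e | inr e, inl v => v \in val e
  | _, _ => false
  end.

Lemma subdiv_sym (G : sgraph) : symmetric (@subdiv_adj G).
Proof. by case=> [v|e] [w|f]. Qed.

Lemma subdiv_irr (G : sgraph) : irreflexive (@subdiv_adj G).
Proof. by case. Qed.

Definition subdivision (G : sgraph) : sgraph :=
  SGraph (@subdiv_sym G) (@subdiv_irr G).

(* H, #|I| copies of K and #|J| copies of L, all disjoint; every vertex of H in
   N i (resp. P j) is joined to every vertex of the i-th copy of K (resp. of
   the j-th copy of L). *)
Section Corona.
Variables (H : sgraph) (I : finType) (N : I -> pred H) (K : sgraph).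
Variables (J : finType) (P : J -> pred H) (L : sgraph).

Definition corona_adj : rel (H + (I * K + J * L)) := fun a b =>
  match a, b with
  | inl x, inl y => adj x y
  | inl x, inr (inl (i, _)) | inr (inl (i, _)), inl x => N i x
  | inl x, inr (inr (j, _)) | inr (inr (j, _)), inl x => P j x
  | inr (inl (i, u)), inr (inl (i', u')) => (i == i') && adj u u'
  | inr (inr (j, w)), inr (inr (j', w')) => (j == j') && adj w w'
  | _, _ => false
  end.

Lemma corona_sym : symmetric corona_adj.
Proof.
by case=> [x|[[i u]|[j w]]] [y|[[i' u']|[j' w']]] //=;
   rewrite (adj_sym _) // eq_sym.
Qed.

Lemma corona_irr : irreflexive corona_adj.
Proof. by case=> [x|[[i u]|[j w]]] /=; rewrite adj_irr ?andbF. Qed.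

Definition corona : sgraph := SGraph corona_sym corona_irr.
End Corona.

(* G1^S \bowtie (G2^V \cup G3^E) *)
Definition vertex_corona (G1 G2 G3 : sgraph) : sgraph :=
  @corona (subdivision G1)
    G1 (fun v => [pred x : subdivision G1 | @adj (subdivision G1) (inl v) x]) G2
    (edge G1) (fun e => [pred x : subdivision G1 | x == inr e]) G3.

(* G1^S \diamondsuit (G2^V \cup G3^E) *)
Definition edge_corona (G1 G2 G3 : sgraph) : sgraph :=
  @corona (subdivision G1)
    (edge G1)
      (fun e => [pred x : subdivision G1 | @adj (subdivision G1) (inr e) x]) G2
    G1 (fun v => [pred x : subdivision G1 | x == inl v]) G3.

Section Spectrum.
Variable R : rcfType.

Definition adjacency_mx (G : sgraph) : 'M[R]_#|G| :=
  \matrix_(i, j) (adj (enum_val i) (enum_val j))%:R.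

(* As 0^-1 = 0, the entries at isolated vertices are 0. *)
Definition degree_isqrt_mx (G : sgraph) : 'M[R]_#|G| :=
  diag_mx (\row_i (Num.sqrt (degree (enum_val i))%:R)^-1).

(* The identity matrix is replaced by the indicator of the non-isolated
   vertices, so that rows and columns of isolated vertices vanish. *)
Definition normalized_laplacian (G : sgraph) : 'M[R]_#|G| :=
  diag_mx (\row_i (0 < degree (enum_val i))%N%:R)
  - degree_isqrt_mx G *m adjacency_mx G *m degree_isqrt_mx G.

(* The eigenvalues lying in R, in non-increasing order, each repeated according
   to its multiplicity as a root of the characteristic polynomial; a symmetric
   matrix over a real closed field has all its eigenvalues in that field. *)
Definition eigenvalues (n : nat) (M : 'M[R]_n) : seq R :=
  sort >=%O (flatten [seq nseq (mup x (char_poly M)) x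
                     | x <- rootsR (char_poly M)]).

Lemma eigenvalues_char_poly (n : nat) (M : 'M[R]_n) (s : seq R) :
  char_poly M = \prod_(x <- s) ('X - x%:P) -> eigenvalues M = sort >=%O s.
Proof.
move=> Ep; rewrite /eigenvalues; set p := char_poly M in Ep *.
have p0 : p != 0 by apply/monic_neq0/char_poly_monic.
apply/perm_sortP; [exact: ge_total | exact: ge_trans | exact: ge_anti |].
apply/allP => x _; apply/eqP; rewrite count_flatten -map_comp.
rewrite -(mu_prod_XsubC x s) -Ep sumnE big_map /=.
under eq_bigr => y _ do rewrite count_nseq /=.
have rE : (x \in rootsR p) = root p x by rewrite -(roots_on_rootsR p0).
case: (boolP (x \in rootsR p)) => [xr | xNr].
  rewrite (bigD1_seq x) ?uniq_roots //= eqxx mul1n big1 ?addn0 // => y.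
  by move=> /negbTE ->.
rewrite mupNroot -?rE // big_seq big1 // => y yr.
by case: eqP => // yx; rewrite -yx yr in xNr.
Qed.

Definition laplacian_eigenvalues (G : sgraph) : seq R :=
  eigenvalues (normalized_laplacian G).

(* Meaningful for connected G only, where 0 is the last and a simple
   eigenvalue. *)
Definition kemeny (G : sgraph) : R :=
  \sum_(i < #|G|.-1) ((laplacian_eigenvalues G)`_i)^-1.

End Spectrum.

(* Main.v *)
Require Import Defs.
From mathcomp Require Import all_boot all_order all_algebra.
From mathcomp Require Import perm spectral sesquilinear complex ring lra.
Set Implicit Arguments.
Unset Strict Implicit.
Unset Printing Implicit Defensive.
Import Order.TTheory GRing.Theory Num.Theory.
Local Open Scope ring_scope.

(** Write p for the characteristic polynomial of the normalized Laplacian of a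
    connected graph.  Zero is a simple root, so p = 'X * q with q(0) <> 0, and
    the sum of the inverses of the other roots is - q'(0) / q(0): Kemeny's
    constant is minus the logarithmic derivative of q at 0.  As logarithmic
    derivatives turn products into sums, both formulas follow from a
    factorization of p, each factor contributing one term.

    The factorization.  For a graph without isolated vertices, p(t) is, up to
    the product of the degrees, the determinant of (t - 1) D + A
    ([det_walk_mx]).  In a corona with regular copies, the block of one copy has
    constant row sums, so the all-one vector is an eigenvector of it and the
    copies can be eliminated by a Schur complement ([det_corona]).  There
    remains a matrix on V(G1) + I(G1) made of scalar blocks, the incidence
    matrix B and B^T B or B B^T; one more elimination, and the exchange of B^T B
    for B B^T where it is needed ([det_subdiv_ul], [det_subdiv_dr]), lead to a
    determinant on V(G1).  Since G1 is regular, B B^T = r1 (2 I - L(G1)), and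
    the blocks (t - 1) D + A of the copies are affine in L(G2) and L(G3); all
    the determinants thus factor over the spectra ([det_incidence],
    [det_regular]).  The results are [vertex_corona_char_poly] and
    [edge_corona_char_poly].

    At t = 0 none of the pivots of the eliminations vanishes, and the value of
    the factor of an eigenvalue theta of G1 is a nonzero multiple of theta.  So
    exactly one factor vanishes at 0, that of the eigenvalue 0 of G1, which is
    simple by connectedness ([connected_spectrum_neq0]); it equals 'X * g, and
    the fraction without summation sign in each formula comes from g.  The
    identities are cleared of denominators; the exponents |V(G1)| and |I(G1)|
    that this introduces recombine into the term in m1 - n1. *)

(** * Block elimination *)

Section Schur.
Variable R : comPzRingType.

(** Elimination of the lower right block D.  Asking for a solution X of
    D X = g C rather than for an inverse of D keeps the identity free of
    denominators, hence valid for singular D too; the scalar g plays the role of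
    the pivot. *)
Lemma det_schur_dr n1 n2 (A : 'M[R]_n1) (B : 'M_(n1, n2)) (C : 'M_(n2, n1))
    (D : 'M_n2) (X : 'M_(n2, n1)) (g : R) :
  D *m X = g *: C ->
  \det (block_mx A B C D) * g ^+ n1 = \det (g *: A - B *m X) * \det D.
Proof.
move=> DX; have <- : \det (block_mx g%:M 0 (- X) 1%:M : 'M_(n1 + n2)) = g ^+ n1.
  by rewrite det_lblock det1 mulr1 det_scalar.
rewrite -det_mulmx mulmx_block !mulmx0 !mulmx1 !mul_mx_scalar !add0r !mulmxN.
by rewrite DX subrr det_ublock.
Qed.

Lemma det_schur_ul n1 n2 (A : 'M[R]_n1) (B : 'M_(n1, n2)) (C : 'M_(n2, n1))
    (D : 'M_n2) (X : 'M_(n1, n2)) (g : R) :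
  A *m X = g *: B ->
  \det (block_mx A B C D) * g ^+ n2 = \det A * \det (g *: D - C *m X).
Proof.
move=> AX; have <- : \det (block_mx 1%:M (- X) 0 g%:M : 'M_(n1 + n2)) = g ^+ n2.
  by rewrite det_ublock det1 mul1r det_scalar.
rewrite -det_mulmx mulmx_block !mulmx0 !mulmx1 !mul_mx_scalar !addr0 !mulmxN.
by rewrite AX addNr det_lblock addrC.
Qed.

(** Both sides are, up to a power of a, the determinant of the block matrix
    with rows (1, f B) and (B^T, a), eliminated in the two possible orders. *)
Lemma det_sylvester n m (a f : R) (B : 'M_(n, m)) :
  a ^+ n * \det (a%:M - f *: (B^T *m B)) =
  a ^+ m * \det (a%:M - f *: (B *m B^T)).
Proof.
have e1 := @det_schur_ul n m 1%:M (f *: B) B^T a%:M (f *: B) 1.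
have e2 := @det_schur_dr n m 1%:M (f *: B) B^T a%:M B^T a.
rewrite expr1n mulr1 det1 mul1r mul1mx !scale1r -scalemxAr in e1.
rewrite mul_scalar_mx det_scalar -scalemxAl scalemx1 e1 // in e2.
by rewrite mulrC e2 // mulrC.
Qed.
End Schur.

(** * Determinants of matrices indexed by finite types *)

Section Indexed.
Variable R : comPzRingType.

(** Rows and columns are labelled by finite types, so that the block structure
    of a matrix can follow the sums and products in the vertex type of a
    corona. *)
Definition fmx (T U : finType) (f : T -> U -> R) : 'M[R]_(#|T|, #|U|) :=
  \matrix_(i, j) f (enum_val i) (enum_val j).

Lemma eq_fmx (T U : finType) (f g : T -> U -> R) : f =2 g -> fmx f = fmx g.
Proof. by move=> fg; apply/matrixP => i j; rewrite !mxE fg. Qed.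

Lemma sum_enum_val (T : finType) (F : T -> R) :
  \sum_(i < #|T|) F (enum_val i) = \sum_x F x.
Proof.
by rewrite [RHS](reindex (@enum_val T T)) //; apply/onW_bij/enum_val_bij.
Qed.

Lemma fmx_mul (T U V : finType) (f : T -> U -> R) (g : U -> V -> R) :
  fmx f *m fmx g = fmx (fun x z => \sum_y f x y * g y z).
Proof.
apply/matrixP => i j; rewrite !mxE -[RHS]sum_enum_val.
by apply: eq_bigr => k _; rewrite !mxE.
Qed.

Lemma fmx_tr (T U : finType) (f : T -> U -> R) :
  (fmx f)^T = fmx (fun y x => f x y).
Proof. by apply/matrixP => i j; rewrite !mxE. Qed.

Lemma fmx_scalar (T : finType) (a : R) :
  fmx (fun x y : T => a * (x == y)%:R) = a%:M.
Proof.
apply/matrixP => i j; rewrite !mxE mulr_natr.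
by rewrite (inj_eq enum_val_inj).
Qed.

(** A bijective relabelling permutes rows and columns in the same way, so the
    two signs cancel. *)
Lemma det_reindex (T : finType) n (s : 'I_n -> T) (f : T -> T -> R) :
  bijective s -> \det (\matrix_(i, j) f (s i) (s j)) = \det (fmx f).
Proof.
move=> bs; have En : n = #|T| by rewrite -(bij_eq_card bs) card_ord.
subst n; have inj : injective (enum_rank \o s).
  by apply: inj_comp (bij_inj bs); apply: enum_rank_inj.
set p := perm inj.
have -> : (\matrix_(i, j) f (s i) (s j)) = row_perm p (col_perm p (fmx f)).
  by apply/matrixP => i j; rewrite !mxE !permE /= !enum_rankK.
rewrite row_permE col_permE !det_mulmx !det_perm mulrCA -[RHS]mulr1.
congr (_ * _).
by rewrite odd_permV -signr_addb addbb.
Qed.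

Lemma det_fmx_bij (T U : finType) (s : T -> U) (f : U -> U -> R) :
  bijective s -> \det (fmx (fun x y => f (s x) (s y))) = \det (fmx f).
Proof.
by move=> bs; rewrite -(det_reindex _ (bij_comp bs (@enum_val_bij T))).
Qed.

Lemma det_fmx_sum (T U : finType) (f : T + U -> T + U -> R) :
  \det (fmx f) = \det (block_mx (fmx (fun x y => f (inl x) (inl y)))
                               (fmx (fun x y => f (inl x) (inr y)))
                               (fmx (fun x y => f (inr x) (inl y)))
                               (fmx (fun x y => f (inr x) (inr y)))).
Proof.
pose s (i : 'I_(#|T| + #|U|)) : T + U :=
  match split i with inl j => inl (enum_val j) | inr j => inr (enum_val j) end.
have bs : bijective s.
  exists (fun z => unsplit (match z with inl x => inl (enum_rank x)
                                 | inr x => inr (enum_rank x) end)).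
    move=> i; rewrite /s -[RHS]splitK.
    by case: (split i) => j; rewrite enum_valK.
  by case=> x; rewrite /s unsplitK enum_rankK.
rewrite -(det_reindex _ bs); congr (\det _); apply/matrixP => i j.
rewrite !mxE /s; case: splitP => k _; rewrite !mxE; case: splitP => l _;
by rewrite !mxE.
Qed.

(** A block diagonal matrix with equal blocks, by induction on the number of
    blocks: I is first relabelled as an ordinal type. *)
Lemma det_fmx_copies (I K : finType) (k : K -> K -> R) :
  \det (fmx (fun x y : I * K => (x.1 == y.1)%:R * k x.2 y.2)) =
  \det (fmx k) ^+ #|I|.
Proof.
have main n : \det (fmx (fun x y : 'I_n * K => (x.1 == y.1)%:R * k x.2 y.2)) =
    \det (fmx k) ^+ n.
  elim: n => [|n IHn].
    rewrite expr0 -(det1 R 0).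
    have e : #|{: 'I_0 * K}| = 0%N by rewrite card_prod card_ord.
    by move: (fmx _); rewrite e => A; rewrite !det_mx00.
  pose s (z : K + 'I_n * K) : 'I_n.+1 * K :=
    match z with inl u => (ord0, u) | inr (i, u) => (lift ord0 i, u) end.
  have bs : bijective s.
    exists (fun z =>
      if unlift ord0 z.1 is Some i then inr (i, z.2) else inl z.2).
      by case=> [u|[i u]] /=; rewrite ?unlift_none ?liftK.
    by case=> i u /=; case: unliftP => [j|] ->.
  rewrite -(det_fmx_bij _ bs) det_fmx_sum.
  set A := fmx _; set B := fmx _; set C := fmx _; set D := fmx _.
  have -> : B = 0.
    apply/matrixP => i j; rewrite !mxE; case: (enum_val j) => ? ? /=.
    by rewrite mul0r.
  rewrite det_lblock exprS; congr (\det _ * _).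
    by apply: eq_fmx => u v; rewrite /s /= mul1r.
  rewrite -IHn; congr (\det _); apply: eq_fmx => -[i u] [j v] /=.
  by rewrite (inj_eq lift_inj).
have bs : bijective (fun z : I * K => (enum_rank z.1, z.2)).
  by exists (fun z => (enum_val z.1, z.2)) => -[i u] /=;
     rewrite ?enum_rankK ?enum_valK.
rewrite -main -(det_fmx_bij _ bs); congr (\det _).
apply: eq_fmx => -[i u] [j v] /=.
by rewrite (inj_eq enum_rank_inj).
Qed.
End Indexed.

(** * Characteristic polynomials *)

Lemma horner_char_poly (R : comNzRingType) n (A : 'M[R]_n) t :
  (char_poly A).[t] = \det (t%:M - A).
Proof.
rewrite -horner_evalE -det_map_mx; congr (\det _).
apply/matrixP => i j; rewrite !mxE /= horner_evalE.
by rewrite hornerD hornerN hornerC hornerMn hornerX.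
Qed.

Lemma char_poly_conj (R : comNzRingType) n (P Q D : 'M[R]_n) :
  P *m Q = 1%:M -> char_poly (P *m D *m Q) = char_poly D.
Proof.
move=> PQ1; have PQ1' : map_mx polyC P *m map_mx polyC Q = 1%:M.
  by rewrite -map_mxM PQ1 map_mx1.
rewrite /char_poly /char_poly_mx !map_mxM.
have XE : 'X%:M = map_mx polyC P *m 'X%:M *m map_mx polyC Q.
  by rewrite mul_mx_scalar -scalemxAl PQ1' scalemx1.
rewrite [in LHS]XE -mulmxBl -mulmxBr !det_mulmx mulrAC -det_mulmx PQ1' det1.
by rewrite mul1r.
Qed.

(** In characteristic zero polynomials may be compared pointwise: the difference
    would otherwise have all of 0, 1, 2, etc. as roots. *)
Lemma polyP_horner (R : numDomainType) (p q : {poly R}) :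
  (forall t, p.[t] = q.[t]) -> p = q.
Proof.
move=> pq; apply/eqP; rewrite -subr_eq0; apply/negPn/negP => nz.
set d := p - q in nz.
have := max_poly_roots (rs := [seq i%:R | i <- iota 0 (size d)]) nz.
rewrite size_map size_iota ltnn => H; suff: false by []; apply: H.
  by apply/allP => x _; rewrite /root hornerD hornerN pq subrr.
by rewrite map_inj_uniq ?iota_uniq // => i j /eqP; rewrite eqr_nat => /eqP.
Qed.

(** The spectral theorem over the complex extension R[i] diagonalizes M with
    real eigenvalues; the factorization then descends to R. *)
Lemma symmetric_char_poly_split (R : rcfType) n (M : 'M[R]_n) : M^T = M ->
  exists s : seq R, char_poly M = \prod_(x <- s) ('X - x%:P).
Proof.
move=> symM; set toC := real_complex R; pose MC := map_mx toC M.
have herm : MC \is hermsymmx.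
  apply: realsym_hermsym.
    apply/is_hermitianmxP; rewrite expr0 scale1r map_mx_id //.
    by rewrite /MC map_trmx symM.
  by apply/mxOverP => i j; rewrite mxE complex_real.
have /mxOverP dR := hermitian_spectral_diag_real herm.
have /hermitian_normalmx/orthomx_spectralP := herm.
set P := spectralmx _; set d := spectral_diag _ => MCE.
exists [seq complex.Re (d 0 i) | i <- enum 'I_n].
apply: (map_poly_inj toC); rewrite map_char_poly -/MC MCE.
rewrite char_poly_conj ?mulVmx ?spectral_unit //.
rewrite char_poly_trig ?diag_mx_is_trig // rmorph_prod big_map big_enum /=.
apply: eq_bigr => i _; rewrite mxE eqxx mulr1n.
by rewrite rmorphB /= map_polyX map_polyC /= RRe_real.
Qed.

(** * The spectrum of a normalized Laplacian *)

Section Laplacian.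
Variables (R : rcfType) (G : sgraph).
Local Notation L := (normalized_laplacian R G).
Local Notation deg x := ((degree x)%:R : R).
Let sq (x : G) : R := Num.sqrt (deg x).
Let isq (x : G) : R := (sq x)^-1.

Lemma degree_sum (x : G) : degree x = (\sum_y adj x y)%N.
Proof.
rewrite /degree -sum1dep_card [LHS]big_mkcond /=.
by apply: eq_bigr => y _; case: adj.
Qed.

Lemma degreeR_sum (x : G) : deg x = \sum_y (adj x y)%:R.
Proof. by rewrite degree_sum natr_sum. Qed.

Lemma adj_degree_gt0 (x y : G) : adj x y -> (0 < degree x)%N.
Proof. by move=> xy; apply/card_gt0P; exists y; rewrite inE. Qed.

Lemma sqr_sq x : sq x * sq x = deg x.
Proof. by rewrite -expr2 sqr_sqrtr ?ler0n. Qed.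

Lemma sq_gt0 x : (0 < sq x) = (0 < degree x)%N.
Proof. by rewrite sqrtr_gt0 ltr0n. Qed.

Lemma laplacianE :
  L = fmx (fun x y => (x == y)%:R * (0 < degree x)%N%:R
                      - isq x * (adj x y)%:R * isq y).
Proof.
apply/matrixP => i j; rewrite /normalized_laplacian /degree_isqrt_mx.
rewrite mul_mx_diag mul_diag_mx !mxE (inj_eq enum_val_inj).
by rewrite mulr_natl.
Qed.

Lemma laplacian_sym : L^T = L.
Proof.
rewrite laplacianE fmx_tr; apply: eq_fmx => x y.
rewrite eq_sym adj_sym; congr (_ - _); last first.
  by rewrite mulrAC [RHS]mulrAC [isq y * _]mulrC.
by case: eqP => [->|]; rewrite ?mul0r.
Qed.

Lemma dirichlet_form (w : G -> R) :
  \sum_x deg x * w x ^+ 2 - \sum_x \sum_y (adj x y)%:R * (w x * w y) =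
  2^-1 * \sum_x \sum_y (adj x y)%:R * (w x - w y) ^+ 2.
Proof.
have e1 : \sum_x deg x * w x ^+ 2 = \sum_x \sum_y (adj x y)%:R * w x ^+ 2.
  by apply: eq_bigr => x _; rewrite degreeR_sum mulr_suml.
have e2 : \sum_x deg x * w x ^+ 2 = \sum_x \sum_y (adj x y)%:R * w y ^+ 2.
  rewrite e1 exchange_big; apply: eq_bigr => x _.
  by apply: eq_bigr => y _; rewrite adj_sym.
have -> : \sum_x \sum_y (adj x y)%:R * (w x - w y) ^+ 2 =
  \sum_x \sum_y (adj x y)%:R * w x ^+ 2 + \sum_x \sum_y (adj x y)%:R * w y ^+ 2
  - 2 * \sum_x \sum_y (adj x y)%:R * (w x * w y).
  rewrite mulr_sumr -sumrN -!big_split; apply: eq_bigr => x _ /=.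
  rewrite mulr_sumr -sumrN -!big_split; apply: eq_bigr => y _ /=; ring.
by rewrite -e1 -e2; field.
Qed.

Lemma laplacian_form (u : 'rV[R]_#|G|) :
  let w x := u 0 (enum_rank x) * isq x in
  (u *m L *m u^T) 0 0 = 2^-1 * \sum_x \sum_y (adj x y)%:R * (w x - w y) ^+ 2.
Proof.
move=> w; rewrite -dirichlet_form.
pose v x := u 0 (enum_rank x).
have -> : (u *m L *m u^T) 0 0 = \sum_x \sum_y v x *
    ((x == y)%:R * (0 < degree x)%N%:R - isq x * (adj x y)%:R * isq y) * v y.
  rewrite mxE [RHS]exchange_big -[RHS]sum_enum_val; apply: eq_bigr => j _.
  rewrite !mxE mulr_suml -[RHS]sum_enum_val; apply: eq_bigr => i _.
  by rewrite laplacianE !mxE /v !enum_valK.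
rewrite -sumrB; apply: eq_bigr => x _.
have -> : deg x * w x ^+ 2 =
    \sum_y v x * ((x == y)%:R * (0 < degree x)%N%:R) * v y.
  rewrite (bigD1 x) //= big1 => [|y /negPf]; last first.
    by rewrite eq_sym => ->; rewrite mul0r mulr0 mul0r.
  rewrite eqxx mul1r addr0 /w -/(v x) -sqr_sq /isq.
  have [d0|d0] := posnP (degree x).
    by rewrite mulr0 mul0r /sq d0 sqrtr0 !mul0r.
  have : sq x != 0 by rewrite gt_eqF // sq_gt0.
  by move=> ?; rewrite mulr1; field.
by rewrite -sumrB; apply: eq_bigr => y _; rewrite /w -!/(v _); ring.
Qed.

Lemma laplacian_form_ge0 (u : 'rV[R]_#|G|) : 0 <= (u *m L *m u^T) 0 0.
Proof.
rewrite laplacian_form mulr_ge0 ?invr_ge0 ?ler0n // sumr_ge0 // => x _.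
by rewrite sumr_ge0 // => y _; rewrite mulr_ge0 ?ler0n ?sqr_ge0.
Qed.

Lemma row_sqnorm_gt0 n (u : 'rV[R]_n) : u != 0 -> 0 < (u *m u^T) 0 0.
Proof.
move=> nz; have ge0 : forall i, predT i -> 0 <= u 0 i * u^T i 0.
  by move=> i _; rewrite mxE -expr2 sqr_ge0.
rewrite mxE lt_def sumr_ge0 // andbT; apply: contraNneq nz => /eqP.
rewrite psumr_eq0 // => /allP s0; apply/eqP/rowP => i; rewrite mxE.
by have := s0 i (mem_index_enum i); rewrite mxE mulf_eq0 orbb => /eqP.
Qed.

Lemma laplacian_root_ge0 a : root (char_poly L) a -> 0 <= a.
Proof.
rewrite -eigenvalue_root_char => /eigenvalueP[u uL nz].
have := laplacian_form_ge0 u; rewrite uL -scalemxAl mxE.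
by rewrite pmulr_lge0 // row_sqnorm_gt0.
Qed.

(** The vector of the square roots of the degrees spans the kernel of the
    Laplacian of a connected graph with an edge.  The entries are put to 1 at
    isolated vertices, where the Laplacian vanishes, so that the vector is
    nonzero in edgeless graphs as well. *)
Definition null_vector : 'rV[R]_#|G| :=
  \row_i (sq (enum_val i) + (degree (enum_val i) == 0)%N%:R).

Lemma null_vector_laplacian : null_vector *m L = 0.
Proof.
apply/rowP => j; rewrite laplacianE !mxE; set y := enum_val j.
rewrite (eq_bigr (fun i => let x := enum_val i in
   (sq x + (degree x == 0)%N%:R) * ((x == y)%:R * (0 < degree x)%N%:R
                      - isq x * (adj x y)%:R * isq y))); last first.
  by move=> i _; rewrite !mxE.
rewrite (sum_enum_val (fun x => (sq x + (degree x == 0)%N%:R) *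
   ((x == y)%:R * (0 < degree x)%N%:R - isq x * (adj x y)%:R * isq y))).
transitivity (\sum_x ((x == y)%:R * sq x - (adj x y)%:R * isq y)).
  apply: eq_bigr => x _; have [d0|d0] := posnP (degree x).
    have -> : adj x y = false by apply/negP => /adj_degree_gt0; rewrite d0.
    by rewrite /isq /sq d0 sqrtr0 !(mulr0, mul0r, subr0).
  have nz : sq x != 0 by rewrite gt_eqF // sq_gt0.
  by rewrite addr0 mulr1; move: (isq y) => b; rewrite /isq; field.
rewrite sumrB (bigD1 y) //= big1 => [|x /negPf->]; last by rewrite mul0r.
rewrite eqxx mul1r addr0 -mulr_suml.
under eq_bigr => x _ do rewrite adj_sym.
rewrite -degreeR_sum -sqr_sq.
have [->|nz] := eqVneq (sq y) 0; first by rewrite !mul0r subr0.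
by rewrite /isq mulfK // subrr.
Qed.

Lemma null_vector_neq0 : (0 < #|G|)%N -> null_vector != 0.
Proof.
move=> /card_gt0P[x _]; apply/eqP => /rowP/(_ (enum_rank x)).
rewrite !mxE enum_rankK; apply/eqP; have [d0|d0] := posnP (degree x).
  by rewrite /sq d0 sqrtr0 add0r oner_eq0.
by rewrite addr0 gt_eqF // sq_gt0.
Qed.

(** As the eigenvalues are nonnegative and 0 is one of them, the non-increasing
    list of eigenvalues ends with 0. *)
Lemma laplacian_spectrum : (0 < #|G|)%N -> exists s : seq R,
  [/\ laplacian_eigenvalues R G = rcons s 0, size s = #|G|.-1,
      {in s, forall x, 0 <= x} &
      char_poly L = 'X * \prod_(x <- s) ('X - x%:P)].
Proof.
move=> G0; have [s0 Es0] := symmetric_char_poly_split laplacian_sym.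
rewrite /laplacian_eigenvalues (eigenvalues_char_poly Es0).
set e := sort _ s0; have pe : perm_eq e s0 by rewrite perm_sort.
have Ee : char_poly L = \prod_(x <- e) ('X - x%:P).
  by rewrite Es0 (perm_big _ pe).
have ge0 x : x \in e -> 0 <= x.
  by move=> xe; apply: laplacian_root_ge0; rewrite Ee root_prod_XsubC.
have e0 : 0 \in e.
  rewrite -root_prod_XsubC -Ee -eigenvalue_root_char; apply/eigenvalueP.
  exists null_vector; last exact: null_vector_neq0.
  by rewrite scale0r null_vector_laplacian.
have : sorted >=%O e by apply: sort_sorted; apply: ge_total.
have sz : size e = #|G|.
  by have := size_char_poly L; rewrite Ee size_prod_XsubC => -[].
case/lastP: e e0 sz ge0 Ee {pe} => // s z e0 sz ge0 Ee so.
have z0 : z = 0.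
  apply/eqP; rewrite eq_le ge0 ?mem_rcons ?mem_head // andbT.
  move: so e0; rewrite sorted_pairwise; last exact: ge_trans.
  rewrite pairwise_rcons => /andP[/allP H _].
  by rewrite mem_rcons inE => /predU1P[<-//|/H].
exists s; split=> [||x xs|]; rewrite ?z0 -?sz ?size_rcons //.
  by apply: ge0; rewrite mem_rcons inE xs orbT.
by rewrite Ee big_rcons z0 subr0 mulrC.
Qed.

Lemma kemenyE s : laplacian_eigenvalues R G = rcons s 0 -> size s = #|G|.-1 ->
  kemeny R G = \sum_(x <- s) x^-1.
Proof.
move=> Es sz; rewrite /kemeny Es -sz (big_nth 0) big_mkord.
by apply: eq_bigr => i _; rewrite nth_rcons ltn_ord.
Qed.

(** Matrix determinant lemma: eliminating either diagonal block of the matrix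
    with rows (t - M, v^T) and (v, 1) computes the same determinant.  Adding
    v^T v thus moves one root 0 of the characteristic polynomial to v v^T and
    leaves the others in place. *)
Lemma char_poly_null_vector n (M : 'M[R]_n) (v : 'rV_n) : M *m v^T = 0 ->
  'X * char_poly (M + v^T *m v) = ('X - ((v *m v^T) 0 0)%:P) * char_poly M.
Proof.
move=> Mv; apply: polyP_horner => t.
rewrite !hornerM hornerX hornerXsubC !horner_char_poly.
have := @det_schur_dr R n 1 (t%:M - M) v^T v 1%:M v 1.
rewrite mul1mx scale1r => /(_ erefl); rewrite expr1n mulr1 det1 mulr1 scale1r.
have := @det_schur_ul R n 1 (t%:M - M) v^T v 1%:M v^T t.
rewrite mulmxBl Mv subr0 mul_scalar_mx expr1 => /(_ erefl) h1 h2.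
rewrite mulrC opprD addrA -h2 h1 mulrC; congr (_ * _).
by rewrite scalemx1 det_mx11 !mxE eqxx mulr1n.
Qed.

(** L + v^T v is positive definite for v the null vector: a vector u with zero
    quadratic form has u / sqrt deg constant along edges, hence everywhere, and
    is orthogonal to v, hence zero. *)
Lemma connected_laplacian_det : connected G -> (forall x : G, 0 < degree x)%N ->
  \det (L + null_vector^T *m null_vector) != 0.
Proof.
move=> [/card_gt0P[x0 _] conG] deg0; set v := null_vector.
have vE x : v 0 (enum_rank x) = sq x.
  by rewrite mxE enum_rankK gtn_eqF ?addr0.
have sq0 x : sq x != 0 by rewrite gt_eqF // sq_gt0.
apply/det0P => -[u nz]; rewrite mulmxDr => /(congr1 (fun z => (z *m u^T) 0 0)).
rewrite mul0mx mulmxDl mulmxA -(mulmxA (u *m _)) [u *m v^T]mx11_scalar.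
set c := (u *m v^T) 0 0.
have -> : v *m u^T = c%:M.
  by rewrite -[v]trmxK -trmx_mul [u *m v^T]mx11_scalar tr_scalar_mx.
rewrite -scalar_mxM mxE [X in _ + X]mxE [RHS]mxE /= mulr1n -expr2 => /eqP.
rewrite paddr_eq0 ?sqr_ge0 ?laplacian_form_ge0 // sqrf_eq0.
case/andP; rewrite laplacian_form mulf_eq0 invr_eq0 pnatr_eq0 /=.
set w := fun x => u 0 (enum_rank x) * isq x => form0 c0.
have uE x : u 0 (enum_rank x) = w x * sq x by rewrite /w /isq mulfVK.
have wadj x y : adj x y -> w x = w y.
  move=> xy; move: form0.
  rewrite psumr_eq0 => [/allP/(_ x (mem_index_enum _))/=|z _].
    rewrite psumr_eq0 => [/allP/(_ y (mem_index_enum _))/=|z _].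
      by rewrite xy mul1r sqrf_eq0 subr_eq0 => /eqP.
    by rewrite mulr_ge0 ?ler0n ?sqr_ge0.
  by rewrite sumr_ge0 // => y' _; rewrite mulr_ge0 ?ler0n ?sqr_ge0.
have wc x : w x = w x0.
  have /connectP[p] := conG x x0; elim: p x => [|y p IHp] x /= => [_ ->//|].
  by case/andP=> /wadj -> /IHp.
move: c0; rewrite /c mxE.
rewrite (eq_bigr (fun k => w x0 * deg (enum_val k))) => [|k _]; last first.
  by rewrite mxE -[k]enum_valK uE vE enum_valK wc -mulrA sqr_sq.
rewrite -mulr_sumr (sum_enum_val (fun x => deg x)) mulf_eq0 => /orP[/eqP w0|].
  case/eqP: nz; apply/rowP => k.
  by rewrite -[k]enum_valK uE wc w0 mul0r mxE.
rewrite psumr_eq0 => [/allP/(_ x0 (mem_index_enum _))|x _]; rewrite ?ler0n //=.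
by rewrite pnatr_eq0 gtn_eqF.
Qed.

(** 0 is a simple eigenvalue.  Were it a root of the cofactor of 'X, it would
    remain a root after the perturbation by v^T v, which makes L invertible. *)
Lemma connected_spectrum_neq0 s :
  connected G -> (forall x : G, 0 < degree x)%N ->
  char_poly L = 'X * \prod_(x <- s) ('X - x%:P) -> {in s, forall x, x != 0}.
Proof.
move=> cG deg0 Es.
have Lv : L *m null_vector^T = 0.
  by rewrite -laplacian_sym -trmx_mul null_vector_laplacian trmx0.
have := char_poly_null_vector Lv; rewrite Es mulrCA.
have X0 : 'X != 0 :> {poly R} by rewrite polyX_eq0.
move/(mulfI X0)/(congr1 (fun p => p.[0])).
rewrite horner_char_poly hornerM horner_prod => E x xs; apply/negP => /eqP x0.
have : \det (0%:M - (L + null_vector^T *m null_vector)) != 0.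
  rewrite raddf0 sub0r -scaleN1r detZ mulf_neq0 ?connected_laplacian_det //.
  by rewrite expf_neq0 ?oppr_eq0 ?oner_eq0.
rewrite E (big_rem x) //= !hornerXsubC x0 subrr mul0r mulr0 eqxx.
by [].
Qed.
End Laplacian.

(** * Determinants of affine combinations of degrees and adjacencies *)

Section Walk.
Variables (R : rcfType) (G : sgraph).
Local Notation L := (normalized_laplacian R G).

Definition walk_mx (y : R) : 'M[R]_#|G| :=
  fmx (fun x z : G => y * (degree x)%:R * (x == z)%:R + (adj x z)%:R).

(** t - L = D^(-1/2) ((t - 1) D + A) D^(-1/2). *)
Lemma det_walk_mx t : (forall x : G, 0 < degree x)%N ->
  (\prod_(x : G) (degree x)%:R) * (char_poly L).[t] = \det (walk_mx (t - 1)).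
Proof.
move=> deg0; rewrite horner_char_poly.
pose sq (x : G) : R := Num.sqrt (degree x)%:R.
have sq0 x : sq x != 0 by rewrite gt_eqF // sqrtr_gt0 ltr0n.
have sqK x : sq x * sq x = (degree x)%:R by rewrite -expr2 sqr_sqrtr ?ler0n.
pose D : 'M[R]_#|G| := diag_mx (\row_i sq (enum_val i)).
have detD : \det D * \det D = \prod_(x : G) (degree x)%:R.
  rewrite det_diag -big_split /= [RHS](reindex (@enum_val G G)) /=; last first.
    by apply: onW_bij; apply: enum_val_bij.
  by apply: eq_bigr => i _; rewrite !mxE sqK.
rewrite -detD mulrAC -!det_mulmx; congr (\det _).
apply/matrixP => i j; rewrite mul_mx_diag mul_diag_mx laplacianE !mxE.
rewrite (inj_eq enum_val_inj) deg0.
set x := enum_val i; set z := enum_val j.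
have nx := sq0 x; have nz := sq0 z; rewrite -/(sq x) -/(sq z) -(sqK x).
case: eqVneq => [ij|_].
  by rewrite (_ : z = x) ?mulr1n; [field | rewrite /z -ij].
by rewrite !(mulr0n, mulr1n); field; apply/andP.
Qed.

Lemma char_poly_homog n (M : 'M[R]_n) (s : seq R) (a b : R) :
  char_poly M = \prod_(x <- s) ('X - x%:P) ->
  \det (a%:M - b *: M) = \prod_(x <- s) (a - b * x).
Proof.
move=> Es; have sz : size s = n.
  by have := size_char_poly M; rewrite Es size_prod_XsubC => -[].
have [->|b0] := eqVneq b 0.
  rewrite scale0r subr0 det_scalar (eq_bigr (fun=> a)) => [|x _]; last first.
    by rewrite mul0r subr0.
  by rewrite big_const_seq count_predT sz iter_mulr_1.
have -> : a%:M - b *: M = b *: ((a / b)%:M - M).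
  by rewrite scalerBr scale_scalar_mx mulrCA divff // mulr1.
rewrite detZ -horner_char_poly Es horner_prod -sz -[size s]count_predT.
rewrite -iter_mulr_1 -big_const_seq -big_split; apply: eq_bigr => x _ /=.
by rewrite hornerXsubC mulrBr mulrCA divff // mulr1.
Qed.

(** r L = r I - A for an r-regular graph, including r = 0, where both sides
    vanish. *)
Lemma det_regular r (a b : R) (s : seq R) : regular G r ->
  char_poly L = \prod_(x <- s) ('X - x%:P) ->
  \det (fmx (fun x y : G => a * (x == y)%:R + b * (adj x y)%:R)) =
  \prod_(x <- s) (a + b * r%:R * (1 - x)).
Proof.
move=> rG Es; transitivity (\det ((a + b * r%:R)%:M - (b * r%:R) *: L)).
  congr (\det _); rewrite laplacianE -fmx_scalar; apply/matrixP => i j.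
  rewrite !mxE; set x := enum_val i; set y := enum_val j; rewrite !rG.
  have [r0|r0] := posnP r.
    suff -> : adj x y = false by rewrite r0 !(mulr0, mul0r, addr0, subr0).
    by apply/negP => /adj_degree_gt0; rewrite rG r0.
  have q0 : Num.sqrt (r%:R : R) != 0 by rewrite gt_eqF // sqrtr_gt0 ltr0n.
  have qq : Num.sqrt (r%:R : R) ^+ 2 = r%:R by rewrite sqr_sqrtr ?ler0n.
  move: (Num.sqrt _) q0 qq => q q0 <-; rewrite (inj_eq enum_val_inj).
  by case: (i == j); rewrite !(mulr0n, mulr1n); field.
by rewrite (char_poly_homog _ _ Es); apply: eq_bigr => x _; ring.
Qed.

End Walk.

(** * Elimination of the copies in a corona *)

Lemma big_prodType (T : Type) (idx : T) (op : Monoid.com_law idx)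
    (A B : finType) (F : A * B -> T) :
  \big[op/idx]_z F z = \big[op/idx]_i \big[op/idx]_u F (i, u).
Proof. by rewrite pair_bigA /=; apply: eq_bigr => -[]. Qed.

Section CoronaDet.
Variables (R : comPzRingType) (H I J K L : finType).
Variables (m : H -> H -> R) (N : I -> pred H) (P : J -> pred H).
Variables (k : K -> K -> R) (l : L -> L -> R) (al be : R).
Hypothesis kE : forall u, \sum_v k u v = al.
Hypothesis lE : forall u, \sum_v l u v = be.

(** The pattern of the adjacency relation of a corona, with arbitrary weights m,
    k and l inside H and inside the copies of K and L; it thus covers all the
    matrices y D + A. *)
Definition corona_fun (a b : H + (I * K + J * L)) : R :=
  match a, b with
  | inl x, inl y => m x y
  | inl x, inr (inl z) | inr (inl z), inl x => (N z.1 x)%:R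
  | inl x, inr (inr z) | inr (inr z), inl x => (P z.1 x)%:R
  | inr (inl z), inr (inl z') => (z.1 == z'.1)%:R * k z.2 z'.2
  | inr (inr z), inr (inr z') => (z.1 == z'.1)%:R * l z.2 z'.2
  | _, _ => 0
  end.

Lemma sum_delta (A : finType) (i : A) (F : A -> R) :
  \sum_j (i == j)%:R * F j = F i.
Proof.
rewrite (bigD1 i) //= eqxx mul1r big1 ?addr0 // => j /negPf.
by rewrite eq_sym => ->; rewrite mul0r.
Qed.

(** All copies are eliminated at once: as k and l have constant row sums al and
    be, the vectors that are constant on each copy solve the linear system of
    [det_schur_dr], with pivot al * be. *)
Lemma det_corona :
  \det (fmx corona_fun) * (al * be) ^+ #|H| =
  \det (fmx (fun x y => al * be * m x y
    - be * #|K|%:R * \sum_i (N i x)%:R * (N i y)%:R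
    - al * #|L|%:R * \sum_j (P j x)%:R * (P j y)%:R))
  * (\det (fmx k) ^+ #|I| * \det (fmx l) ^+ #|J|).
Proof.
pose X (z : I * K + J * L) (x : H) : R :=
  match z with inl z => be * (N z.1 x)%:R | inr z => al * (P z.1 x)%:R end.
rewrite det_fmx_sum (@det_schur_dr _ _ _ _ _ _ _ (fmx X)).
  congr (_ * _).
    rewrite fmx_mul; congr (\det _); apply/matrixP => i j; rewrite !mxE.
    set x := enum_val i; set y := enum_val j.
    rewrite big_sumType opprD addrA !big_prodType /X /=.
    congr (_ - _ - _); rewrite mulr_sumr; apply: eq_bigr => i' _.
      by rewrite sumr_const -mulr_natr; ring.
    by rewrite sumr_const -mulr_natr; ring.
  rewrite det_fmx_sum /=.
  set B := fmx _; set C := fmx _; set D := fmx _; set E := fmx _.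
  have -> : C = 0 by apply/matrixP => i j; rewrite !mxE.
  by rewrite det_lblock -!det_fmx_copies.
rewrite fmx_mul; apply/matrixP => i j; rewrite !mxE.
case: (enum_val i) => [[i' u]|[j' w]]; rewrite big_sumType !big_prodType /X /=.
  rewrite [X in _ + X]big1 ?addr0 => [|i1 _]; last first.
    by rewrite big1 // => *; rewrite mul0r.
  under eq_bigr => i1 _ do (under eq_bigr => u1 _ do rewrite -mulrA;
     rewrite -mulr_sumr -mulr_suml kE).
  by rewrite (sum_delta _ (fun i1 => al * (be * (N i1 _)%:R))) mulrA.
rewrite big1 ?add0r => [|i1 _]; last by rewrite big1 // => *; rewrite mul0r.
under eq_bigr => i1 _ do (under eq_bigr => u1 _ do rewrite -mulrA;
     rewrite -mulr_sumr -mulr_suml lE).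
rewrite (sum_delta _ (fun i1 => be * (al * (P i1 _)%:R))).
by rewrite mulrA [be * al]mulrC.
Qed.
End CoronaDet.

(** * Incidences and degrees *)

Section EdgeCounts.
Variable G : sgraph.

Lemma edge_endpoint (v : G) (e : {set G}) : e \in edges G -> v \in e ->
  exists2 y, adj v y & e = [set v; y].
Proof.
case/imsetP=> -[a b]; rewrite inE /= => ab ->.
rewrite !inE => /orP[/eqP->|/eqP->]; first by exists b.
by exists a; rewrite 1?adj_sym // setUC.
Qed.

Lemma pair_edge (v y : G) : adj v y -> [set v; y] \in edges G.
Proof. by move=> vy; apply/imsetP; exists (v, y); rewrite ?inE. Qed.

Lemma set2_inj (v : G) : injective (fun y => [set v; y]).
Proof.
move=> y z /= e; have /set2P[yv|//] : y \in [set v; z] by rewrite -e set22.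
by have /set2P[zv|->//] : z \in [set v; y]; [rewrite e set22 | rewrite yv zv].
Qed.

(** The edges at v correspond to the neighbours of v. *)
Lemma sum_edges_at (v : G) (F : {set G} -> nat) :
  (\sum_(e : edge G) (v \in val e) * F (val e) =
   \sum_y adj v y * F [set v; y])%N.
Proof.
transitivity (\sum_(e in [set [set v; y] | y in adj v]) F e)%N; last first.
  rewrite big_imset /=; last by move=> y z _ _; apply: set2_inj.
  rewrite [LHS]big_mkcond; apply: eq_bigr => y _.
  by rewrite -topredE /=; case: adj; rewrite ?mul1n ?mul0n.
rewrite -(big_sub (mem (edges G)) (fun e => (v \in e) * F e)%N) big_mkcond.
rewrite [RHS]big_mkcond; apply: eq_bigr => e _ /=.
have -> : (e \in [set [set v; y] | y in adj v]) = (e \in edges G) && (v \in e).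
  apply/imsetP/andP => [[y vy ->]|[eG ve]]; first by rewrite pair_edge ?set21.
  by have [y vy ->] := edge_endpoint eG ve; exists y.
by case: (e \in edges G) => //=; case: (v \in e); rewrite ?mul1n.
Qed.

Lemma sum_incident_edges (v : G) :
  (\sum_(e : edge G) (v \in val e) = degree v)%N.
Proof.
rewrite degree_sum; transitivity (\sum_(e : edge G) (v \in val e) * 1)%N.
  by apply: eq_bigr => e _; rewrite muln1.
by rewrite (sum_edges_at v (fun=> 1%N)); apply: eq_bigr => y _; rewrite muln1.
Qed.

Lemma sum_endpoints (e : edge G) : (\sum_(v : G) (v \in val e) = 2)%N.
Proof.
case: e => e /= /imsetP[[a b]]; rewrite inE /= => ab ->.
have nab : a != b by apply/eqP => E; rewrite E adj_irr in ab.
transitivity #|[set a; b]|; last by rewrite cards2 nab.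
by rewrite -sum1_card [RHS]big_mkcond; apply: eq_bigr => v _; case: (v \in _).
Qed.

Lemma sum_common_edges (v w : G) :
  (\sum_(e : edge G) (v \in val e) * (w \in val e) =
   (v == w) * degree v + adj v w)%N.
Proof.
rewrite (sum_edges_at v (fun e => nat_of_bool (w \in e))).
have [<-|vw] := eqVneq v w.
  rewrite adj_irr addn0 mul1n degree_sum; apply: eq_bigr => y _.
  by rewrite set21 muln1.
rewrite mul0n (bigD1 w) //= set22 muln1 big1 ?addn0 // => y yw.
by rewrite in_set2 eq_sym (negPf vw) eq_sym (negPf yw) muln0.
Qed.

Lemma card_edge : #|edge G| = #|edges G|.
Proof. by rewrite card_sig; apply: eq_card => e; rewrite inE. Qed.

Lemma degree_subdiv (x : subdivision G) :
  degree x = match x with inl v => degree v | inr _ => 2 end.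
Proof.
rewrite degree_sum big_sumType /=; case: x => [v|e] /=.
  by rewrite big1 // add0n sum_incident_edges.
by rewrite sum_endpoints big1.
Qed.

End EdgeCounts.

Section CoronaDegree.
Variables (H : sgraph) (I : finType) (N : I -> pred H) (K : sgraph).
Variables (J : finType) (P : J -> pred H) (L : sgraph).
Local Notation G := (corona N K P L).

Lemma degree_corona (a : G) : degree a =
  match a with
  | inl x => (degree x + (\sum_i N i x) * #|K| + (\sum_j P j x) * #|L|)%N
  | inr (inl (i, u)) => (degree u + \sum_x N i x)%N
  | inr (inr (j, w)) => (degree w + \sum_x P j x)%N
  end.
Proof.
have in_copy (A : finType) (B : sgraph) (i : A) (u : B) :
    (\sum_i' \sum_u' ((i == i') && adj u u') = degree u)%N.
  rewrite (bigD1 i) //= [X in (_ + X)%N]big1 ?addn0 => [|i' /negPf ii'].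
    by rewrite degree_sum; apply: eq_bigr => v _; rewrite eqxx.
  by rewrite big1 // => v _; rewrite eq_sym ii'.
have no_edge (A B : finType) : (\sum_(i : A) \sum_(u : B) 0 = 0)%N.
  by rewrite big1 // => i _; rewrite big1.
rewrite degree_sum !big_sumType !big_prodType /=.
case: a => [x|[[i u]|[j w]]] /=;
  rewrite ?in_copy ?no_edge ?addn0 ?add0n 1?addnC //.
rewrite -degree_sum addnC addnA; congr (_ + _ + _)%N; rewrite big_distrl /=;
  by apply: eq_bigr => i _; rewrite sum_nat_const mulnC.
Qed.

(** Puts the matrix (t - 1) D + A of a corona in the form to which [det_corona]
    applies: in all copies of K, resp. of L, the vertices have the same degree,
    so that the diagonal blocks of the copies are equal. *)
Lemma walk_mx_corona (R : rcfType) (y : R) (rK rL dN dP : nat) :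
  regular K rK -> regular L rL ->
  (forall i, \sum_x N i x = dN)%N -> (forall j, \sum_x P j x = dP)%N ->
  walk_mx G y = fmx (corona_fun
    (fun x z => y * (degree (inl x : G))%:R * (x == z)%:R + (adj x z)%:R) N P
    (fun u v : K => y * (rK + dN)%:R * (u == v)%:R + 1 * (adj u v)%:R)
    (fun u v : L => y * (rL + dP)%:R * (u == v)%:R + 1 * (adj u v)%:R)).
Proof.
move=> regK regL EN EP; apply: eq_fmx => a b.
case: a => [x|[[i u]|[j w]]]; case: b => [x'|[[i' u']|[j' w']]] //=;
  rewrite ?mulr0 ?add0r //.
- rewrite degree_corona regK EN mul1r.
  have -> : (inr (inl (i, u)) == inr (inl (i', u')) :> G) =
    (i == i') && (u == u') by [].
  by case: eqP; rewrite ?mul1r // !mulr0 !mul0r addr0.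
rewrite degree_corona regL EP mul1r.
have -> : (inr (inr (j, w)) == inr (inr (j', w')) :> G) =
  (j == j') && (w == w') by [].
by case: eqP; rewrite ?mul1r // !mulr0 !mul0r addr0.
Qed.

End CoronaDegree.

(** * Elimination in the subdivision graph *)

Section SubdivisionDet.
Variables (R : comPzRingType) (n m : nat) (B : 'M[R]_(n, m)) (a b c e : R).

(** Eliminating the first block leaves a determinant in B^T B, which
    [det_sylvester] exchanges for one in B B^T. *)
Lemma det_subdiv_ul :
  \det (block_mx a%:M (b *: B) (b *: B^T) (c%:M - e *: (B^T *m B)))
    * a ^+ m * (a * c) ^+ n =
  a ^+ n * (a * c) ^+ m
    * \det ((a * c)%:M - (a * e + b ^+ 2) *: (B *m B^T)).
Proof.
rewrite (@det_schur_ul _ _ _ _ _ _ _ (b *: B)) ?mul_scalar_mx // det_scalar.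
rewrite -!mulrA -det_sylvester.
congr (_ * _); rewrite mulrC; congr (_ * \det _).
rewrite scalerBr scale_scalar_mx scalerA -scalemxAl -scalemxAr scalerA.
by rewrite scalerDl opprD addrA.
Qed.

Lemma det_subdiv_dr :
  \det (block_mx (c%:M - e *: (B *m B^T)) (b *: B) (b *: B^T) a%:M) * a ^+ n =
  a ^+ m * \det ((a * c)%:M - (a * e + b ^+ 2) *: (B *m B^T)).
Proof.
rewrite (@det_schur_dr _ _ _ _ _ _ _ (b *: B^T)) ?mul_scalar_mx //.
rewrite det_scalar mulrC; congr (_ * \det _).
rewrite scalerBr scale_scalar_mx scalerA -scalemxAl -scalemxAr scalerA.
by rewrite scalerDl opprD addrA.
Qed.
End SubdivisionDet.

Section Incidence.
Variables (R : rcfType) (G : sgraph).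

Definition incidence_mx : 'M[R]_(#|G|, #|edge G|) :=
  fmx (fun (v : G) (e : edge G) => (v \in val e)%:R).
Local Notation B := incidence_mx.

Lemma incidence_mul_tr :
  B *m B^T = fmx (fun v w : G => (degree v)%:R * (v == w)%:R + (adj v w)%:R).
Proof.
rewrite fmx_tr fmx_mul; apply: eq_fmx => v w.
rewrite -natrM -natrD mulnC -sum_common_edges natr_sum.
by apply: eq_bigr => e _; rewrite natrM.
Qed.

Lemma det_incidence r (c f : R) (s : seq R) : regular G r ->
  char_poly (normalized_laplacian R G) = \prod_(x <- s) ('X - x%:P) ->
  \det (c%:M - f *: (B *m B^T)) = \prod_(x <- s) (c - f * (r%:R * (2 - x))).
Proof.
move=> rG Es; transitivity
  (\det (fmx (fun v w : G =>
    (c - f * r%:R) * (v == w)%:R + (- f) * (adj v w)%:R))).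
  rewrite incidence_mul_tr -fmx_scalar; congr (\det _); apply/matrixP => i j.
  by rewrite !mxE rG; ring.
by rewrite (det_regular _ _ rG Es); apply: eq_bigr => x _; ring.
Qed.
End Incidence.

(** * The characteristic polynomials of the two coronas *)

Section CoronaCharPoly.
Variables (R : rcfType) (G1 G2 G3 : sgraph) (r1 r2 r3 : nat).
Variables (s1 s2 s3 : seq R).
Hypotheses (rG1 : regular G1 r1) (rG2 : regular G2 r2) (rG3 : regular G3 r3).
Hypothesis r1_gt0 : (0 < r1)%N.
Hypothesis Es1 :
  char_poly (normalized_laplacian R G1) = \prod_(x <- s1) ('X - x%:P).
Hypothesis Es2 :
  char_poly (normalized_laplacian R G2) = \prod_(x <- s2) ('X - x%:P).
Hypothesis Es3 :
  char_poly (normalized_laplacian R G3) = \prod_(x <- s3) ('X - x%:P).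
Local Notation n1 := #|G1|.
Local Notation n2 := #|G2|.
Local Notation n3 := #|G3|.
Local Notation m1 := #|edge G1|.

Lemma sum_regular (G : sgraph) r (a b : R) (u : G) : regular G r ->
  \sum_v (a * (u == v)%:R + b * (adj u v)%:R) = a + b * r%:R.
Proof.
move=> rG; rewrite big_split -!mulr_sumr -degreeR_sum rG (bigD1 u) //= eqxx.
by rewrite big1 ?addr0 ?mulr1 // => v /negPf; rewrite eq_sym => ->.
Qed.

Let sum_false_l (A : finType) (F : A -> R) : \sum_i false%:R * F i = 0.
Proof. by rewrite big1 // => i _; rewrite mul0r. Qed.

Let sum_false_r (A : finType) (F : A -> R) : \sum_i F i * false%:R = 0.
Proof. by rewrite big1 // => i _; rewrite mulr0. Qed.

Lemma sum_pred1 (T : finType) (x : T) : (\sum_y (x == y) = 1)%N.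
Proof.
rewrite (bigD1 x) //= eqxx big1 // => y /negPf.
by rewrite eq_sym => ->.
Qed.

Let Nv (v : G1) : pred (subdivision G1) :=
  [pred x : subdivision G1 | @adj (subdivision G1) (inl v) x].
Let Pe (e : edge G1) : pred (subdivision G1) :=
  [pred x : subdivision G1 | x == inr e].

Let sum_Nv v : (\sum_x Nv v x = r1)%N.
Proof.
transitivity (@degree (subdivision G1) (inl v)); first by rewrite degree_sum.
by rewrite degree_subdiv.
Qed.

Let sum_Pe e : (\sum_x Pe e x = 1)%N.
Proof.
rewrite -(sum_pred1 (inr e : subdivision G1)); apply: eq_bigr => x _.
by rewrite eq_sym.
Qed.

Lemma degree_vertex_corona (x : vertex_corona G1 G2 G3) :
  degree x = match x with
             | inl (inl _) => r1
             | inl (inr _) => (2 + 2 * n2 + n3)%N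
             | inr (inl _) => (r2 + r1)%N
             | inr (inr _) => (r3 + 1)%N
             end.
Proof.
rewrite (@degree_corona _ _ Nv _ _ Pe).
case: x => [[v|e]|[[i u]|[j w]]]; rewrite ?degree_subdiv ?rG1.
- rewrite [X in (_ + X * _ + _)%N]big1 // [X in (_ + _ + X * _)%N]big1 //.
  by rewrite !mul0n !addn0.
- have -> : (\sum_v Nv v (inr e) = 2)%N by rewrite -(sum_endpoints e).
  by rewrite (sum_pred1 e) mul1n.
- by rewrite rG2 sum_Nv.
by rewrite rG3 sum_Pe.
Qed.

(** Here al and be are the row sums of the diagonal blocks of the copies of G2
    and G3, while a and c are the scalar parts of the blocks on V(G1) and I(G1)
    that are left once the copies are eliminated. *)
Lemma vertex_corona_char_poly (t : R) :
  let y := t - 1 in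
  let al := y * (r2 + r1)%:R + r2%:R in
  let be := y * (r3 + 1)%:R + r3%:R in
  let a := al * be * (y * r1%:R) in
  let c := al * be * (y * (2 + 2 * n2 + n3)%:R) - al * n3%:R in
  (\prod_(x : vertex_corona G1 G2 G3) (degree x)%:R)
    * (char_poly (normalized_laplacian R (vertex_corona G1 G2 G3))).[t]
    * (al * be) ^+ (n1 + m1) * a ^+ m1 * (a * c) ^+ n1 =
  a ^+ n1 * (a * c) ^+ m1
    * \prod_(x <- s1)
        (a * c - (a * (be * n2%:R) + (al * be) ^+ 2) * (r1%:R * (2 - x)))
    * ((\prod_(x <- s2) (y * (r2 + r1)%:R + 1 * r2%:R * (1 - x))) ^+ n1
      * (\prod_(x <- s3) (y * (r3 + 1)%:R + 1 * r3%:R * (1 - x))) ^+ m1).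
Proof.
move=> y al be a c.
rewrite det_walk_mx -/y; last first.
  by move=> x; rewrite degree_vertex_corona; case: x => [[v|e]|[[i u]|[j w]]];
     rewrite ?addn1 // ltn_addl.
rewrite (walk_mx_corona _ rG2 rG3 sum_Nv sum_Pe).
have -> : (n1 + m1)%N = #|{: G1 + edge G1}| by rewrite card_sum.
rewrite (@det_corona _ _ _ _ _ _ _ _ _ _ _ al be); last 2 first.
- by move=> u; rewrite (sum_regular _ _ _ rG2) mul1r.
- by move=> u; rewrite (sum_regular _ _ _ rG3) mul1r.
rewrite (det_regular _ _ rG2 Es2) (det_regular _ _ rG3 Es3).
(* The determinants of the copies are the same on both sides. *)
set KL := (X in _ = _ * X); rewrite [_ * KL]mulrC [RHS]mulrC -!(mulrA KL).
congr (_ * _); rewrite -(det_incidence _ _ rG1 Es1) -det_subdiv_ul det_fmx_sum.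
congr (\det (block_mx _ _ _ _) * _ * _).
- rewrite -fmx_scalar; apply: eq_fmx => v w; rewrite degree_vertex_corona.
  by rewrite /Nv /Pe /= !sum_false_l !mulr0 !subr0 addr0 mulrA.
- apply/matrixP => i j; rewrite !mxE /Nv /Pe /= !sum_false_l.
  by rewrite !mulr0 !subr0 add0r.
- apply/matrixP => i j; rewrite !mxE /Nv /Pe /= !sum_false_r.
  by rewrite !mulr0 !subr0 add0r.
rewrite fmx_tr fmx_mul -fmx_scalar; apply/matrixP => i j; rewrite !mxE.
set e := enum_val i; set f := enum_val j; rewrite degree_vertex_corona.
pose F u : R := (e == u)%:R * (f == u)%:R.
by rewrite (eq_bigr F) // sum_delta /= /c [f == e]eq_sym; ring.
Qed.

Let Ne (e : edge G1) : pred (subdivision G1) :=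
  [pred x : subdivision G1 | @adj (subdivision G1) (inr e) x].
Let Pv (v : G1) : pred (subdivision G1) :=
  [pred x : subdivision G1 | x == inl v].

Let sum_Ne e : (\sum_x Ne e x = 2)%N.
Proof.
transitivity (@degree (subdivision G1) (inr e)); first by rewrite degree_sum.
by rewrite degree_subdiv.
Qed.

Let sum_Pv v : (\sum_x Pv v x = 1)%N.
Proof.
rewrite -(sum_pred1 (inl v : subdivision G1)); apply: eq_bigr => x _.
by rewrite eq_sym.
Qed.

Lemma degree_edge_corona (x : edge_corona G1 G2 G3) :
  degree x = match x with
             | inl (inl _) => (r1 + r1 * n2 + n3)%N
             | inl (inr _) => 2
             | inr (inl _) => (r2 + 2)%N
             | inr (inr _) => (r3 + 1)%N
             end.
Proof.
rewrite (@degree_corona _ _ Ne _ _ Pv).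
case: x => [[v|e]|[[i u]|[j w]]]; rewrite ?degree_subdiv ?rG1.
- have -> : (\sum_e Ne e (inl v) = r1)%N.
    by rewrite -(rG1 v) -sum_incident_edges.
  by rewrite (sum_pred1 v) mul1n.
- by rewrite [X in (_ + X * _ + _)%N]big1 // [X in (_ + _ + X * _)%N]big1.
- by rewrite rG2 sum_Ne.
by rewrite rG3 sum_Pv.
Qed.

(** The roles of V(G1) and I(G1) are exchanged: now c belongs to V(G1), whose
    block contains B B^T, and a to I(G1). *)
Lemma edge_corona_char_poly (t : R) :
  let y := t - 1 in
  let al := y * (r2 + 2)%:R + r2%:R in
  let be := y * (r3 + 1)%:R + r3%:R in
  let a := al * be * (y * 2%:R) in
  let c := al * be * (y * (r1 + r1 * n2 + n3)%:R) - al * n3%:R in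
  (\prod_(x : edge_corona G1 G2 G3) (degree x)%:R)
    * (char_poly (normalized_laplacian R (edge_corona G1 G2 G3))).[t]
    * (al * be) ^+ (n1 + m1) * a ^+ n1 =
  a ^+ m1
    * \prod_(x <- s1)
        (a * c - (a * (be * n2%:R) + (al * be) ^+ 2) * (r1%:R * (2 - x)))
    * ((\prod_(x <- s2) (y * (r2 + 2)%:R + 1 * r2%:R * (1 - x))) ^+ m1
      * (\prod_(x <- s3) (y * (r3 + 1)%:R + 1 * r3%:R * (1 - x))) ^+ n1).
Proof.
move=> y al be a c.
rewrite det_walk_mx -/y; last first.
  by move=> x; rewrite degree_edge_corona; case: x => [[v|e]|[[i u]|[j w]]];
     rewrite ?addn1 ?addn2 // -addnA ltn_addr.
rewrite (walk_mx_corona _ rG2 rG3 sum_Ne sum_Pv).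
have -> : (n1 + m1)%N = #|{: G1 + edge G1}| by rewrite card_sum.
rewrite (@det_corona _ _ _ _ _ _ _ _ _ _ _ al be); last 2 first.
- by move=> u; rewrite (sum_regular _ _ _ rG2) mul1r.
- by move=> u; rewrite (sum_regular _ _ _ rG3) mul1r.
rewrite (det_regular _ _ rG2 Es2) (det_regular _ _ rG3 Es3).
(* The determinants of the copies are the same on both sides. *)
set KL := (X in _ = _ * X); rewrite [_ * KL]mulrC [RHS]mulrC -!(mulrA KL).
congr (_ * _); rewrite -(det_incidence _ _ rG1 Es1) -det_subdiv_dr det_fmx_sum.
congr (\det (block_mx _ _ _ _) * _).
- rewrite fmx_tr fmx_mul -fmx_scalar; apply/matrixP => i j; rewrite !mxE.
  set v := enum_val i; set w := enum_val j; rewrite degree_edge_corona.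
  pose F u : R := (v == u)%:R * (w == u)%:R.
  rewrite [X in _ - al * _ * X](eq_bigr F) // sum_delta /=.
  by rewrite /c [w == v]eq_sym; ring.
- apply/matrixP => i j; rewrite !mxE /Ne /Pv /= !sum_false_r.
  by rewrite !mulr0 !subr0 add0r.
- apply/matrixP => i j; rewrite !mxE /Ne /Pv /= !sum_false_l.
  by rewrite !mulr0 !subr0 add0r.
rewrite -fmx_scalar; apply: eq_fmx => e f; rewrite degree_edge_corona.
by rewrite /Ne /Pv /= !sum_false_l !mulr0 !subr0 addr0 mulrA.
Qed.

End CoronaCharPoly.

(** * Logarithmic derivatives at zero *)

Section LogDerivative.
Variable R : fieldType.
Implicit Types p q : {poly R}.

(** A relation rather than the quotient p'(0) / p(0): it carries along the
    condition p(0) <> 0 under which logarithmic derivatives are additive. *)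
Definition is_logderiv0 p (l : R) := p.[0] != 0 /\ p^`().[0] = l * p.[0].

Lemma is_logderiv0E p v d : p.[0] = v -> p^`().[0] = d -> v != 0 ->
  is_logderiv0 p (d / v).
Proof. by move=> pv pd v0; split; rewrite pv ?pd // divfK. Qed.

Lemma is_logderiv0C c : c != 0 -> is_logderiv0 c%:P 0.
Proof. by move=> c0; split; rewrite ?derivC ?hornerC ?mul0r. Qed.

Lemma is_logderiv0M p q l l' :
  is_logderiv0 p l -> is_logderiv0 q l' -> is_logderiv0 (p * q) (l + l').
Proof.
move=> [p0 pl] [q0 ql]; split; first by rewrite hornerM mulf_neq0.
by rewrite derivM hornerD !hornerM pl ql; ring.
Qed.

Lemma is_logderiv0X p l n :
  is_logderiv0 p l -> is_logderiv0 (p ^+ n) (n%:R * l).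
Proof.
move=> pl; elim: n => [|n IHn].
  by rewrite mul0r; apply: is_logderiv0C; apply: oner_neq0.
by rewrite exprS -[n.+1%:R]natr1 mulrDl mul1r addrC; apply: is_logderiv0M.
Qed.

Lemma is_logderiv0_prod (I : eqType) (s : seq I)
    (F : I -> {poly R}) (l : I -> R) :
  {in s, forall x, is_logderiv0 (F x) (l x)} ->
  is_logderiv0 (\prod_(x <- s) F x) (\sum_(x <- s) l x).
Proof.
elim: s => [_|x s IHs Fl].
  by rewrite !big_nil; apply: is_logderiv0C; apply: oner_neq0.
rewrite !big_cons; apply: is_logderiv0M; first by apply: Fl; rewrite mem_head.
by apply: IHs => y ys; apply: Fl; rewrite inE ys orbT.
Qed.

Lemma is_logderiv0_inj p l l' : is_logderiv0 p l -> is_logderiv0 p l' -> l = l'.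
Proof. by move=> [p0 pl] [_ pl']; apply: (mulIf p0); rewrite -pl. Qed.

Lemma is_logderiv0_div p q l l' :
  is_logderiv0 (p * q) l -> is_logderiv0 q l' -> is_logderiv0 p (l - l').
Proof.
move=> [pq0 pql] [q0 ql]; move: pq0; rewrite hornerM mulf_eq0 => /norP[p0 _].
split=> //; apply: (mulIf q0); move: pql.
rewrite derivM hornerD !hornerM ql => E.
by rewrite mulrBl mulrBl -[l * _ * _]mulrA -E; ring.
Qed.

Lemma sum_inv_roots (s : seq R) l :
  is_logderiv0 (\prod_(x <- s) ('X - x%:P)) l -> \sum_(x <- s) x^-1 = - l.
Proof.
move=> sl; apply/eqP; rewrite eq_sym eqr_oppLR; apply/eqP.
apply: (is_logderiv0_inj sl).
rewrite -sumrN; apply: is_logderiv0_prod => x xs.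
have x0 : x != 0.
  apply: contraNneq (proj1 sl) => x0; rewrite horner_prod (big_rem x) //=.
  by rewrite hornerXsubC x0 subrr mul0r.
by split; rewrite ?derivXsubC !hornerE ?sub0r ?oppr_eq0 // mulrNN mulVf.
Qed.
End LogDerivative.

(** * From the factorizations to the sums of inverse roots *)

Section Sums.
Variables (R : rcfType) (n1 m1 : nat) (n2 n3 r1 r2 r3 : R) (c0 : R).
Variables (s s1 s2 s3 : seq R).
Hypotheses (c0_neq0 : c0 != 0) (r1_gt0 : 0 < r1).
Hypotheses (r2_ge0 : 0 <= r2) (r3_ge0 : 0 <= r3).
Hypotheses (n2_ge0 : 0 <= n2) (n3_ge0 : 0 <= n3).
Hypothesis s1_neq0 : {in s1, forall x, x != 0}.
Hypothesis s2_ge0 : {in s2, forall x, 0 <= x}.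
Hypothesis s3_ge0 : {in s3, forall x, 0 <= x}.

(** In its application s lists the nonzero eigenvalues of the corona, c0 is the
    product of its degrees, and s1, s2 and s3 list the eigenvalues of G1, G2 and
    G3 apart from one eigenvalue 0; the hypothesis is then
    [vertex_corona_char_poly].  The conclusion compares the logarithmic
    derivatives at 0 of both sides, once freed from their common factor t. *)
Lemma vertex_corona_sum :
  (forall t : R,
  let y := t - 1 in
  let al := y * (r2 + r1) + r2 in
  let be := y * (r3 + 1) + r3 in
  let a := al * be * (y * r1) in
  let c := al * be * (y * (2 + 2 * n2 + n3)) - al * n3 in
  c0 * (t * \prod_(x <- s) (t - x))
    * (al * be) ^+ (n1 + m1) * a ^+ m1 * (a * c) ^+ n1 =
  a ^+ n1 * (a * c) ^+ m1
    * \prod_(x <- rcons s1 0)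
        (a * c - (a * (be * n2) + (al * be) ^+ 2) * (r1 * (2 - x)))
    * ((\prod_(x <- rcons s2 0) (y * (r2 + r1) + 1 * r2 * (1 - x))) ^+ n1
      * (\prod_(x <- rcons s3 0) (y * (r3 + 1) + 1 * r3 * (1 - x))) ^+ m1)) ->
  size s1 = n1.-1 -> (0 < n1)%N ->
  \sum_(x <- s) x^-1 =
    \sum_(x <- s2) n1%:R * (r1 + r2) / (r1 + r2 * x)
    + \sum_(x <- s1)
       ((4 * r1 + r2 + r1 * r3) * (2 * n2 + n3 + 2) - n3 * (2 * r1 + r2)
        - (2 - x) * ((1 + n2) * (2 * r1 + r1 * r3) + r2))
       / (r1 * (1 + n2) * x)
    + (m1%:R - n1%:R) * (r3 + 2) * (2 * n2 + n3 + 2) / (2 * n2 + 2)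
    + ((2 * n2 + n3 + 2) * (6 * r1 + 3 * r2 + 3 * r1 * r3 + r2 * r3)
       - n3 * (r1 + r2) - 2 * (r3 + 1) * (r1 + r2 + r1 * n2))
      / ((4 * r1 + r2 + r1 * r3) * (2 * n2 + n3 + 2)
         - (2 * r1 * n3 + r2 * n3 + 2 * r2)
         - (2 + 2 * n2) * (2 * r1 + r1 * r3))
    + \sum_(x <- s3) m1%:R * (r3 + 1) / (1 + r3 * x).
Proof.
move=> Hid sz n1_gt0.
have r1n0 : r1 != 0 by rewrite gt_eqF.
have n2n0 : 1 + n2 != 0 by rewrite gt_eqF // ltr_pwDl.
pose d := 2 + 2 * n2 + n3.
pose Y : {poly R} := 'X - 1%:P.
pose AL := Y * (r2 + r1)%:P + r2%:P.
pose BE := Y * (r3 + 1)%:P + r3%:P.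
pose A := AL * BE * (Y * r1%:P).
pose E := BE * Y * d%:P - n3%:P.
pose C := AL * E.
(* The factor of the eigenvalue x of G1, without the pivots that divide it. *)
pose F x := AL * Y * E - BE * (Y * (r1 * n2)%:P + AL) * (2 - x)%:P.
pose F2 x := Y * (r2 + r1)%:P + (r2 * (1 - x))%:P.
pose F3 x := Y * (r3 + 1)%:P + (r3 * (1 - x))%:P.
pose a' := r2 + r1; pose c' := r3 + 1.
(* F 0 divided by 'X: each of the products AL * BE * Y ^+ 2, AL * Y, BE * Y and
   AL * BE, summed in F 0, is replaced by its part divisible by 'X, divided by
   'X; their constant terms cancel out. *)
pose g : {poly R} :=
  d%:P * (AL * BE * ('X - 2%:P) + ((a' * c')%:P * 'X - (a' + r1 * c')%:P))
  - n3%:P * (a'%:P * 'X - (a' + r1)%:P)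
  - (2 * r1 * n2)%:P * (c'%:P * 'X - (c' + 1)%:P)
  - 2%:P * ((a' * c')%:P * 'X - (a' + r1 * c')%:P).
pose Q := \prod_(x <- s) ('X - x%:P).
have F0 : F 0 = 'X * g.
  apply: polyP_horner => t.
  by rewrite /F /g /E /AL /BE /Y /a' /c' /d !hornerE /=; ring.
(* The hypothesis as an identity of polynomials, with a factor 'X cancelled. *)
have Hpoly : Q * (c0%:P * (AL * BE) ^+ (n1 + m1) * A ^+ m1 * (A * C) ^+ n1) =
    A ^+ n1 * (A * C) ^+ m1
    * ((AL * BE * r1%:P) ^+ n1 * \prod_(x <- s1) F x * g)
    * (((\prod_(x <- s2) F2 x) * AL) ^+ n1
      * ((\prod_(x <- s3) F3 x) * BE) ^+ m1).
  have X0 : 'X != 0 :> {poly R} by rewrite polyX_eq0.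
  apply: (mulfI X0); apply: polyP_horner => t.
  have eAL : (t - 1) * (r2 + r1) + r2 = AL.[t] by rewrite /AL /Y !hornerE /=.
  have eBE : (t - 1) * (r3 + 1) + r3 = BE.[t] by rewrite /BE /Y !hornerE /=.
  have eA : A.[t] = AL.[t] * BE.[t] * ((t - 1) * r1).
    by rewrite /A /Y !hornerE /=.
  have eC : C.[t] = AL.[t] * BE.[t] * ((t - 1) * d) - AL.[t] * n3.
    by rewrite /C /E /Y !hornerE /=; ring.
  have e1 x : A.[t] * C.[t] - (A.[t] * (BE.[t] * n2) + (AL.[t] * BE.[t]) ^+ 2)
      * (r1 * (2 - x)) = AL.[t] * BE.[t] * r1 * (F x).[t].
    by rewrite eA eC /F /E /Y !hornerE /=; ring.
  have e2 x : (t - 1) * (r2 + r1) + 1 * r2 * (1 - x) = (F2 x).[t].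
    by rewrite /F2 /Y !hornerE /=; ring.
  have e3 x : (t - 1) * (r3 + 1) + 1 * r3 * (1 - x) = (F3 x).[t].
    by rewrite /F3 /Y !hornerE /=; ring.
  have F20 : F2 0 = AL by rewrite /F2 subr0 mulr1.
  have F30 : F3 0 = BE by rewrite /F3 subr0 mulr1.
  move: (Hid t); rewrite /= eAL eBE -eA -eC.
  rewrite (eq_bigr _ (fun x _ => e1 x)) (eq_bigr _ (fun x _ => e2 x)).
  rewrite (eq_bigr _ (fun x _ => e3 x)).
  rewrite !big_rcons /= F20 F30 F0 big_split /=.
  rewrite big_const_seq count_predT sz iter_mulr_1.
  rewrite /Q !(hornerM, hornerC, hornerX, horner_exp, horner_prod).
  under [in X in _ -> X]eq_bigr => x _ do rewrite hornerXsubC.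
  have -> : (AL.[t] * BE.[t] * r1) ^+ n1 =
      (AL.[t] * BE.[t] * r1) ^+ n1.-1 * (AL.[t] * BE.[t] * r1).
    by rewrite -exprSr prednK.
  by move=> HH; apply: etrans (etrans _ HH) _; ring.
have n2p : 0 < 2 + 2 * n2 by rewrite ltr_pwDl ?mulr_ge0 ?ler0n ?ltr0n.
pose den := (4 * r1 + r2 + r1 * r3) * (2 * n2 + n3 + 2)
  - (2 * r1 * n3 + r2 * n3 + 2 * r2) - (2 + 2 * n2) * (2 * r1 + r1 * r3).
pose num := (2 * n2 + n3 + 2) * (6 * r1 + 3 * r2 + 3 * r1 * r3 + r2 * r3)
  - n3 * (r1 + r2) - 2 * (r3 + 1) * (r1 + r2 + r1 * n2).
pose numF x := (4 * r1 + r2 + r1 * r3) * (2 * n2 + n3 + 2) - n3 * (2 * r1 + r2)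
  - (2 - x) * ((1 + n2) * (2 * r1 + r1 * r3) + r2).
have den_gt0 : 0 < den.
  have -> : den =
      4 * r1 + (4 * (r1 * n2) + 2 * (r2 * n2) + n3 * (2 * r1 + r1 * r3)).
    by rewrite /den; ring.
  have r1_ge0 := ltW r1_gt0.
  rewrite ltr_pwDl ?mulr_gt0 ?addr_ge0 ?mulr_ge0 ?ler0n ?ltr0n //.
  by rewrite addr_ge0 ?mulr_ge0 ?ler0n.
(* The values and the derivatives at 0 of all the factors. *)
have dAL : is_logderiv0 AL ((r2 + r1) / - r1).
  by apply: is_logderiv0E; rewrite ?oppr_eq0 //;
     rewrite /AL /Y !(derivE, hornerE) /=; ring.
have dBE : is_logderiv0 BE ((r3 + 1) / -1).
  by apply: is_logderiv0E; rewrite ?oppr_eq0 ?oner_eq0 //;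
  rewrite /BE /Y !(derivE, hornerE) /=; ring.
have dY : is_logderiv0 (Y * r1%:P) (r1 / - r1).
  by apply: is_logderiv0E; rewrite ?oppr_eq0 // /Y !(derivE, hornerE) /=; ring.
have dE : is_logderiv0 E (- ((r3 + 2) * d) / (2 + 2 * n2)).
  by apply: is_logderiv0E; rewrite ?gt_eqF //;
  rewrite /E /BE /Y /d !(derivE, hornerE) /=; ring.
have dF :
    {in s1, forall x, is_logderiv0 (F x) (- numF x / (r1 * (1 + n2) * x))}.
  move=> x /s1_neq0 x0; apply: is_logderiv0E; rewrite ?mulf_neq0 //;
  by rewrite /numF /F /AL /E /BE /Y /d !(derivE, hornerE) /=; ring.
have dg : is_logderiv0 g (num / - den).
  apply: is_logderiv0E; rewrite ?oppr_eq0 ?gt_eqF //;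
  by rewrite /num /den /g /AL /BE /Y /a' /c' /d !(derivE, hornerE) /=; ring.
have pos2 x : x \in s2 -> r1 + r2 * x != 0.
  by move=> /s2_ge0 x0; rewrite gt_eqF // ltr_pwDl // mulr_ge0.
have pos3 x : x \in s3 -> 1 + r3 * x != 0.
  by move=> /s3_ge0 x0; rewrite gt_eqF // ltr_pwDl // mulr_ge0.
have dF2 : {in s2, forall x, is_logderiv0 (F2 x) ((r2 + r1) / - (r1 + r2 * x))}.
  move=> x /pos2 x0; apply: is_logderiv0E; rewrite ?oppr_eq0 //;
  by rewrite /F2 /Y !(derivE, hornerE) /=; ring.
have dF3 : {in s3, forall x, is_logderiv0 (F3 x) ((r3 + 1) / - (1 + r3 * x))}.
  move=> x /pos3 x0; apply: is_logderiv0E; rewrite ?oppr_eq0 //;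
  by rewrite /F3 /Y !(derivE, hornerE) /=; ring.
have dA := is_logderiv0M (is_logderiv0M dAL dBE) dY.
have dC := is_logderiv0M dAL dE.
have dAC := is_logderiv0M dA dC.
have dr1 := is_logderiv0M (is_logderiv0M dAL dBE) (is_logderiv0C r1n0).
have dL := is_logderiv0M (is_logderiv0M (is_logderiv0M (is_logderiv0C c0_neq0)
  (is_logderiv0X (n1 + m1) (is_logderiv0M dAL dBE))) (is_logderiv0X m1 dA))
  (is_logderiv0X n1 dAC).
have dR := is_logderiv0M (is_logderiv0M
   (is_logderiv0M (is_logderiv0X n1 dA) (is_logderiv0X m1 dAC))
   (is_logderiv0M
     (is_logderiv0M (is_logderiv0X n1 dr1) (is_logderiv0_prod dF)) dg))
   (is_logderiv0M (is_logderiv0X n1 (is_logderiv0M (is_logderiv0_prod dF2) dAL))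
     (is_logderiv0X m1 (is_logderiv0M (is_logderiv0_prod dF3) dBE))).
rewrite -Hpoly in dR; rewrite (sum_inv_roots (is_logderiv0_div dR dL)).
rewrite -/num -/den.
have -> : \sum_(x <- s1) (- numF x / (r1 * (1 + n2) * x)) =
   - \sum_(x <- s1) (numF x / (r1 * (1 + n2) * x)).
  by rewrite -sumrN; apply: eq_bigr => x _; rewrite mulNr.
have -> : \sum_(x <- s2) n1%:R * (r1 + r2) / (r1 + r2 * x) =
   - n1%:R * \sum_(x <- s2) ((r2 + r1) / - (r1 + r2 * x)).
  rewrite mulr_sumr; apply: eq_bigr => x _; rewrite invrN; ring.
have -> : \sum_(x <- s3) m1%:R * (r3 + 1) / (1 + r3 * x) =
   - m1%:R * \sum_(x <- s3) ((r3 + 1) / - (1 + r3 * x)).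
  rewrite mulr_sumr; apply: eq_bigr => x _; rewrite invrN; ring.
rewrite -/(numF _) natrD.
move: (\sum_(x <- s1) _) (\sum_(x <- s2) _) (\sum_(x <- s3) _) => S1 S2 S3.
have denn0 : den != 0 by rewrite gt_eqF.
have n2n0' : 2 + 2 * n2 != 0 by rewrite gt_eqF.
have n2n0'' : 2 * n2 + 2 != 0 by rewrite addrC.
by rewrite /d; clearbody num den; field; rewrite denn0 n2n0'' r1n0.
Qed.

(** The analogue for [edge_corona_char_poly], with the same notations in the
    proof: F collects the factors of the eigenvalues of G1, and g is F 0 divided
    by 'X. *)
Lemma edge_corona_sum :
  (forall t : R,
  let y := t - 1 in
  let al := y * (r2 + 2) + r2 in
  let be := y * (r3 + 1) + r3 in
  let a := al * be * (y * 2) in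
  let c := al * be * (y * (r1 + r1 * n2 + n3)) - al * n3 in
  c0 * (t * \prod_(x <- s) (t - x)) * (al * be) ^+ (n1 + m1) * a ^+ n1 =
  a ^+ m1
    * \prod_(x <- rcons s1 0)
        (a * c - (a * (be * n2) + (al * be) ^+ 2) * (r1 * (2 - x)))
    * ((\prod_(x <- rcons s2 0) (y * (r2 + 2) + 1 * r2 * (1 - x))) ^+ m1
      * (\prod_(x <- rcons s3 0) (y * (r3 + 1) + 1 * r3 * (1 - x))) ^+ n1)) ->
  size s1 = n1.-1 -> (0 < n1)%N ->
  \sum_(x <- s) x^-1 =
    \sum_(x <- s1)
       (2 * (r1 * n2 + r1 + n3) * (2 * r3 + r2 + 8) - (2 * r2 * n3 + 8 * n3)
        - r1 * (2 - x) * ((2 + 2 * n2) * (2 + r3) + r2))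
       / (r1 * (2 + 2 * n2) * x)
    + \sum_(x <- s2) m1%:R * (r2 + 2) / (2 + r2 * x)
    + (r2 + 4) * (m1%:R - n1%:R) / 2
    + (2 * (r1 * n2 + r1 + n3) * (r2 * r3 + 6 * r3 + 3 * r2 + 12)
       - n3 * (2 * r2 + 4) - 2 * r1 * (r3 + 1) * (2 * n2 + r2 + 2))
      / (2 * n2 * r1 * r2 + 8 * n2 * r1 + 4 * n3 * r3 + 8 * n3 + 8 * r1)
    + \sum_(x <- s3) n1%:R * (r3 + 1) / (1 + r3 * x).
Proof.
move=> Hid sz n1_gt0.
have r1n0 : r1 != 0 by rewrite gt_eqF.
have n2p : 0 < 2 + 2 * n2 by rewrite ltr_pwDl ?mulr_ge0 ?ler0n ?ltr0n.
have n2n0 : 2 + 2 * n2 != 0 by rewrite gt_eqF.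
pose d := r1 + r1 * n2 + n3.
pose Y : {poly R} := 'X - 1%:P.
pose AL := Y * (r2 + 2)%:P + r2%:P.
pose BE := Y * (r3 + 1)%:P + r3%:P.
pose A := AL * BE * (Y * 2%:P).
pose E := BE * Y * d%:P - n3%:P.
pose C := AL * E.
pose F x := 2%:P * Y * AL * E - BE * (Y * (2 * n2)%:P + AL) * (r1 * (2 - x))%:P.
pose F2 x := Y * (r2 + 2)%:P + (r2 * (1 - x))%:P.
pose F3 x := Y * (r3 + 1)%:P + (r3 * (1 - x))%:P.
pose a' := r2 + 2; pose c' := r3 + 1.
pose g : {poly R} :=
  (2 * d)%:P * (AL * BE * ('X - 2%:P) + ((a' * c')%:P * 'X - (a' + 2 * c')%:P))
  - (2 * n3)%:P * (a'%:P * 'X - (a' + 2)%:P)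
  - (4 * r1 * n2)%:P * (c'%:P * 'X - (c' + 1)%:P)
  - (2 * r1)%:P * ((a' * c')%:P * 'X - (a' + 2 * c')%:P).
pose Q := \prod_(x <- s) ('X - x%:P).
have F0 : F 0 = 'X * g.
  apply: polyP_horner => t.
  by rewrite /F /g /E /AL /BE /Y /a' /c' /d !hornerE /=; ring.
have Hpoly : Q * (c0%:P * (AL * BE) ^+ (n1 + m1) * A ^+ n1) =
    A ^+ m1 * ((AL * BE) ^+ n1 * \prod_(x <- s1) F x * g)
    * (((\prod_(x <- s2) F2 x) * AL) ^+ m1
      * ((\prod_(x <- s3) F3 x) * BE) ^+ n1).
  have X0 : 'X != 0 :> {poly R} by rewrite polyX_eq0.
  apply: (mulfI X0); apply: polyP_horner => t.
  have eAL : (t - 1) * (r2 + 2) + r2 = AL.[t] by rewrite /AL /Y !hornerE /=.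
  have eBE : (t - 1) * (r3 + 1) + r3 = BE.[t] by rewrite /BE /Y !hornerE /=.
  have eA : A.[t] = AL.[t] * BE.[t] * ((t - 1) * 2).
    by rewrite /A /Y !hornerE /=.
  have eC : C.[t] = AL.[t] * BE.[t] * ((t - 1) * d) - AL.[t] * n3.
    by rewrite /C /E /Y !hornerE /=; ring.
  have e1 x : A.[t] * C.[t] - (A.[t] * (BE.[t] * n2) + (AL.[t] * BE.[t]) ^+ 2)
      * (r1 * (2 - x)) = AL.[t] * BE.[t] * (F x).[t].
    by rewrite eA eC /F /E /Y !hornerE /=; ring.
  have e2 x : (t - 1) * (r2 + 2) + 1 * r2 * (1 - x) = (F2 x).[t].
    by rewrite /F2 /Y !hornerE /=; ring.
  have e3 x : (t - 1) * (r3 + 1) + 1 * r3 * (1 - x) = (F3 x).[t].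
    by rewrite /F3 /Y !hornerE /=; ring.
  have F20 : F2 0 = AL by rewrite /F2 subr0 mulr1.
  have F30 : F3 0 = BE by rewrite /F3 subr0 mulr1.
  move: (Hid t); rewrite /= eAL eBE -eA -eC.
  rewrite (eq_bigr _ (fun x _ => e1 x)) (eq_bigr _ (fun x _ => e2 x)).
  rewrite (eq_bigr _ (fun x _ => e3 x)).
  rewrite !big_rcons /= F20 F30 F0 big_split /=.
  rewrite big_const_seq count_predT sz iter_mulr_1.
  rewrite /Q !(hornerM, hornerC, hornerX, horner_exp, horner_prod).
  under [in X in _ -> X]eq_bigr => x _ do rewrite hornerXsubC.
  have -> : (AL.[t] * BE.[t]) ^+ n1 =
      (AL.[t] * BE.[t]) ^+ n1.-1 * (AL.[t] * BE.[t]).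
    by rewrite -exprSr prednK.
  by move=> HH; apply: etrans (etrans _ HH) _; ring.
pose den := 2 * n2 * r1 * r2 + 8 * n2 * r1 + 4 * n3 * r3 + 8 * n3 + 8 * r1.
pose num := 2 * (r1 * n2 + r1 + n3) * (r2 * r3 + 6 * r3 + 3 * r2 + 12)
  - n3 * (2 * r2 + 4) - 2 * r1 * (r3 + 1) * (2 * n2 + r2 + 2).
pose numF x := 2 * (r1 * n2 + r1 + n3) * (2 * r3 + r2 + 8)
  - (2 * r2 * n3 + 8 * n3)
  - r1 * (2 - x) * ((2 + 2 * n2) * (2 + r3) + r2).
have den_gt0 : 0 < den.
  have r1_ge0 := ltW r1_gt0.
  by rewrite ltr_wpDl ?mulr_gt0 ?ltr0n // !addr_ge0 ?mulr_ge0 ?ler0n.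
have dAL : is_logderiv0 AL ((r2 + 2) / -2).
  by apply: is_logderiv0E; rewrite ?oppr_eq0 ?pnatr_eq0 //;
  rewrite /AL /Y !(derivE, hornerE) /=; ring.
have dBE : is_logderiv0 BE ((r3 + 1) / -1).
  by apply: is_logderiv0E; rewrite ?oppr_eq0 ?oner_eq0 //;
  rewrite /BE /Y !(derivE, hornerE) /=; ring.
have dY : is_logderiv0 (Y * 2%:P) (2 / - 2).
  by apply: is_logderiv0E; rewrite ?oppr_eq0 ?pnatr_eq0 //;
     rewrite /Y !(derivE, hornerE) /=; ring.
have dF :
    {in s1, forall x, is_logderiv0 (F x) (- numF x / (r1 * (2 + 2 * n2) * x))}.
  move=> x /s1_neq0 x0; apply: is_logderiv0E; rewrite ?mulf_neq0 //;
  by rewrite /numF /F /AL /E /BE /Y /d !(derivE, hornerE) /=; ring.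
have dg : is_logderiv0 g (num / - den).
  apply: is_logderiv0E; rewrite ?oppr_eq0 ?gt_eqF //;
  by rewrite /num /den /g /AL /BE /Y /a' /c' /d !(derivE, hornerE) /=; ring.
have pos2 x : x \in s2 -> 2 + r2 * x != 0.
  by move=> /s2_ge0 x0; rewrite gt_eqF // ltr_pwDl // mulr_ge0.
have pos3 x : x \in s3 -> 1 + r3 * x != 0.
  by move=> /s3_ge0 x0; rewrite gt_eqF // ltr_pwDl // mulr_ge0.
have dF2 : {in s2, forall x, is_logderiv0 (F2 x) ((r2 + 2) / - (2 + r2 * x))}.
  move=> x /pos2 x0; apply: is_logderiv0E; rewrite ?oppr_eq0 //;
  by rewrite /F2 /Y !(derivE, hornerE) /=; ring.
have dF3 : {in s3, forall x, is_logderiv0 (F3 x) ((r3 + 1) / - (1 + r3 * x))}.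
  move=> x /pos3 x0; apply: is_logderiv0E; rewrite ?oppr_eq0 //;
  by rewrite /F3 /Y !(derivE, hornerE) /=; ring.
have dAB := is_logderiv0M dAL dBE.
have dA := is_logderiv0M dAB dY.
have dL := is_logderiv0M (is_logderiv0M (is_logderiv0C c0_neq0)
  (is_logderiv0X (n1 + m1) dAB)) (is_logderiv0X n1 dA).
have dR := is_logderiv0M (is_logderiv0M (is_logderiv0X m1 dA)
   (is_logderiv0M
     (is_logderiv0M (is_logderiv0X n1 dAB) (is_logderiv0_prod dF)) dg))
   (is_logderiv0M (is_logderiv0X m1 (is_logderiv0M (is_logderiv0_prod dF2) dAL))
     (is_logderiv0X n1 (is_logderiv0M (is_logderiv0_prod dF3) dBE))).
rewrite -Hpoly in dR; rewrite (sum_inv_roots (is_logderiv0_div dR dL)).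
rewrite -/num -/den.
have -> : \sum_(x <- s1) (- numF x / (r1 * (2 + 2 * n2) * x)) =
   - \sum_(x <- s1) (numF x / (r1 * (2 + 2 * n2) * x)).
  by rewrite -sumrN; apply: eq_bigr => x _; rewrite mulNr.
have -> : \sum_(x <- s2) m1%:R * (r2 + 2) / (2 + r2 * x) =
   - m1%:R * \sum_(x <- s2) ((r2 + 2) / - (2 + r2 * x)).
  rewrite mulr_sumr; apply: eq_bigr => x _; rewrite invrN; ring.
have -> : \sum_(x <- s3) n1%:R * (r3 + 1) / (1 + r3 * x) =
   - n1%:R * \sum_(x <- s3) ((r3 + 1) / - (1 + r3 * x)).
  rewrite mulr_sumr; apply: eq_bigr => x _; rewrite invrN; ring.
rewrite -/(numF _) natrD.
move: (\sum_(x <- s1) _) (\sum_(x <- s2) _) (\sum_(x <- s3) _) => S1 S2 S3.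
have denn0 : den != 0 by rewrite gt_eqF.
by rewrite /d; clearbody num den; field; rewrite denn0.
Qed.
End Sums.

(** * Kemeny's constant of the two coronas *)

Lemma sum_nth_rcons (R : nmodType) (F : R -> R) (s : seq R) (z : R) n :
  size s = n -> \sum_(i < n) F (rcons s z)`_i = \sum_(x <- s) F x.
Proof.
move=> <-; rewrite (big_nth 0) big_mkord.
by apply: eq_bigr => i _; rewrite nth_rcons ltn_ord.
Qed.

Theorem theorem4p4 (R : rcfType) (G1 G2 G3 : sgraph)
  (n1 n2 n3 m1 m2 m3 r1 r2 r3 : nat) (theta mu eta : seq R) :
  #|G1| = n1 -> #|G2| = n2 -> #|G3| = n3 ->
  (1 <= n1)%N -> (1 <= n2)%N -> (1 <= n3)%N ->
  #|edges G1| = m1 -> #|edges G2| = m2 -> #|edges G3| = m3 ->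
  regular G1 r1 -> regular G2 r2 -> regular G3 r3 ->
  connected G1 -> (1 <= r1)%N ->
  theta = laplacian_eigenvalues R G1 ->
  mu = laplacian_eigenvalues R G2 ->
  eta = laplacian_eigenvalues R G3 ->
  kemeny R (vertex_corona G1 G2 G3) =
    \sum_(j < n2.-1)
       n1%:R * (r1%:R + r2%:R) / (r1%:R + r2%:R * mu`_j)
    + \sum_(i < n1.-1)
       ((4 * r1%:R + r2%:R + r1%:R * r3%:R) * (2 * n2%:R + n3%:R + 2)
        - n3%:R * (2 * r1%:R + r2%:R)
        - (2 - theta`_i)
          * ((1 + n2%:R) * (2 * r1%:R + r1%:R * r3%:R) + r2%:R))
       / (r1%:R * (1 + n2%:R) * theta`_i)
    + (m1%:R - n1%:R) * (r3%:R + 2) * (2 * n2%:R + n3%:R + 2)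
      / (2 * n2%:R + 2)
    + ((2 * n2%:R + n3%:R + 2)
         * (6 * r1%:R + 3 * r2%:R + 3 * r1%:R * r3%:R + r2%:R * r3%:R)
       - n3%:R * (r1%:R + r2%:R)
       - 2 * (r3%:R + 1) * (r1%:R + r2%:R + r1%:R * n2%:R))
      / ((4 * r1%:R + r2%:R + r1%:R * r3%:R) * (2 * n2%:R + n3%:R + 2)
         - (2 * r1%:R * n3%:R + r2%:R * n3%:R + 2 * r2%:R)
         - (2 + 2 * n2%:R) * (2 * r1%:R + r1%:R * r3%:R))
    + \sum_(k < n3.-1)
       m1%:R * (r3%:R + 1) / (1 + r3%:R * eta`_k)
  /\
  kemeny R (edge_corona G1 G2 G3) =
    \sum_(i < n1.-1)
       (2 * (r1%:R * n2%:R + r1%:R + n3%:R) * (2 * r3%:R + r2%:R + 8)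
        - (2 * r2%:R * n3%:R + 8 * n3%:R)
        - r1%:R * (2 - theta`_i)
          * ((2 + 2 * n2%:R) * (2 + r3%:R) + r2%:R))
       / (r1%:R * (2 + 2 * n2%:R) * theta`_i)
    + \sum_(j < n2.-1)
       m1%:R * (r2%:R + 2) / (2 + r2%:R * mu`_j)
    + (r2%:R + 4) * (m1%:R - n1%:R) / 2
    + (2 * (r1%:R * n2%:R + r1%:R + n3%:R)
         * (r2%:R * r3%:R + 6 * r3%:R + 3 * r2%:R + 12)
       - n3%:R * (2 * r2%:R + 4)
       - 2 * r1%:R * (r3%:R + 1) * (2 * n2%:R + r2%:R + 2))
      / (2 * n2%:R * r1%:R * r2%:R + 8 * n2%:R * r1%:R
         + 4 * n3%:R * r3%:R + 8 * n3%:R + 8 * r1%:R)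
    + \sum_(k < n3.-1)
       n1%:R * (r3%:R + 1) / (1 + r3%:R * eta`_k).
Proof.
move=> <- <- <- n1_gt0 n2_gt0 n3_gt0 <- _ _ rG1 rG2 rG3 cG1 r1_gt0 -> -> ->.
have [s1 [-> sz1 _ E1]] := laplacian_spectrum R n1_gt0.
have [s2 [-> sz2 ge2 E2]] := laplacian_spectrum R n2_gt0.
have [s3 [-> sz3 ge3 E3]] := laplacian_spectrum R n3_gt0.
have neq1 : {in s1, forall x, x != 0}.
  by apply: (connected_spectrum_neq0 cG1 _ E1) => x; rewrite rG1.
have rc s : 'X * \prod_(x <- s) ('X - x%:P) =
    \prod_(x <- rcons s 0) ('X - x%:P) :> {poly R}.
  by rewrite big_rcons /= subr0 mulrC.
rewrite rc in E1; rewrite rc in E2; rewrite rc in E3; rewrite -card_edge.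
have r1R : 0 < r1%:R :> R by rewrite ltr0n.
have horner_roots s t : ('X * \prod_(x <- s) ('X - x%:P)).[t] =
    t * \prod_(x <- s) (t - x) :> R.
  rewrite hornerM hornerX horner_prod; congr (_ * _).
  by apply: eq_bigr => x _; rewrite hornerXsubC.
split.
  have G0 : (0 < #|vertex_corona G1 G2 G3|)%N.
    by case/card_gt0P: n1_gt0 => v _; apply/card_gt0P; exists (inl (inl v)).
  have [s [Es sz _ Ecp]] := laplacian_spectrum R G0.
  rewrite (kemenyE Es sz).
  have c0 : \prod_(x : vertex_corona G1 G2 G3) (degree x)%:R != 0 :> R.
    apply/prodf_neq0 => x _; rewrite pnatr_eq0 -lt0n.
    rewrite (degree_vertex_corona rG1 rG2 rG3).
    by case: x => [[v|e]|[[i u]|[j w]]]; rewrite ?addn1 // ltn_addl.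
  rewrite (@vertex_corona_sum R #|G1| #|edge G1| #|G2|%:R #|G3|%:R
    r1%:R r2%:R r3%:R _ s s1 s2 s3 c0) ?ler0n //.
    by rewrite -(sum_nth_rcons _ 0 sz1) -(sum_nth_rcons _ 0 sz2)
               -(sum_nth_rcons _ 0 sz3).
  move=> t; have := vertex_corona_char_poly rG1 rG2 rG3 r1_gt0 E1 E2 E3 t.
  have -> : (2 + 2 * #|G2| + #|G3|)%:R = 2 + 2 * #|G2|%:R + #|G3|%:R :> R.
    by rewrite 2!natrD natrM.
  by rewrite Ecp horner_roots !natrD.
have G0 : (0 < #|edge_corona G1 G2 G3|)%N.
  by case/card_gt0P: n1_gt0 => v _; apply/card_gt0P; exists (inl (inl v)).
have [s [Es sz _ Ecp]] := laplacian_spectrum R G0.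
rewrite (kemenyE Es sz).
have c0 : \prod_(x : edge_corona G1 G2 G3) (degree x)%:R != 0 :> R.
  apply/prodf_neq0 => x _; rewrite pnatr_eq0 -lt0n.
  rewrite (degree_edge_corona rG1 rG2 rG3).
  by case: x => [[v|e]|[[i u]|[j w]]]; rewrite ?addn1 ?addn2 // -addnA ltn_addr.
rewrite (@edge_corona_sum R #|G1| #|edge G1| #|G2|%:R #|G3|%:R
  r1%:R r2%:R r3%:R _ s s1 s2 s3 c0) ?ler0n //.
  by rewrite -(sum_nth_rcons _ 0 sz1) -(sum_nth_rcons _ 0 sz2)
             -(sum_nth_rcons _ 0 sz3).
move=> t; have := edge_corona_char_poly rG1 rG2 rG3 r1_gt0 E1 E2 E3 t.
have -> : (r1 + r1 * #|G2| + #|G3|)%:R =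
    r1%:R + r1%:R * #|G2|%:R + #|G3|%:R :> R.
  by rewrite 2!natrD natrM.
by rewrite Ecp horner_roots !natrD.
Qed.
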